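(* Let $U\subseteq\mathbb{R}^3$ be a connected open set and let $f:U\to\mathbb{R}$ be a smooth non-constant function whose invariants $X$ and $Y$ both vanish identically. Then, up to scale and conformal transformation, $f$ is one of the functions $$x_1,\qquad \log(x_1{}^2+x_2{}^2+x_3{}^2),\qquad \arctan\left(\frac{x_3}{x_2}\right),\qquad \frac{x_1}{x_1{}^2+x_2{}^2+x_3{}^2}.$$ That is, every point of $U$ has an open neighbourhood $W$ on which $f=c\,(h\circ\Phi)$, where $c$ is a non-zero real constant, $\Phi$ is a conformal (M\''obius) transformation of $\mathbb{R}^3\cup\{\infty\}$, and $h$ is one of the four listed functions (with $\arctan(x_3/x_2)$ understood as a smooth local branch), defined and smooth on $\Phi(W)\subseteq\mathbb{R}^3$.
   Context: Indices run over $1,2,3$ and refer to standard coordinates on $\mathbb{R}^3$; they are raised and lowered with the Euclidean metric and repeated indices are summed. $f_i$ and $f_{ij}$ denote first and second partial derivatives of $f$. Define $$J=f^if_i,\qquad Z=f^{ij}f_if_j+Jf^j{}_j,\qquad X=2f_i{}^jf_jf^{ik}f_k-Jf^{jk}f_{jk}+J(f^j{}_j)^2,\qquad Y=Z^2-2JX .$$ *)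

(* Defs.v *)
From mathcomp Require Import all_boot all_order all_algebra.
From mathcomp Require Import all_classical all_reals all_analysis.
Set Implicit Arguments.
Unset Strict Implicit.
Unset Printing Implicit Defensive.
Import Order.TTheory GRing.Theory Num.Theory.
Import numFieldNormedType.Exports.

Local Open Scope classical_set_scope.
Local Open Scope ring_scope.

(* The library norm on row vectors is the sup norm, which induces the usual
   topology; all metric notions below go through the Euclidean product [dot]. *)
Notation R3 R := ('rV[R]_3) (only parsing).

Definition dot (R : realType) (u v : R3 R) : R := \sum_i u 0 i * v 0 i.

(* The coordinates x_1, x_2, x_3 have indices 0, 1, 2. *)
Definition crd1 (R : realType) (x : R3 R) : R := x 0 (@Ordinal 3 0 isT).
Definition crd2 (R : realType) (x : R3 R) : R := x 0 (@Ordinal 3 1 isT).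
Definition crd3 (R : realType) (x : R3 R) : R := x 0 (@Ordinal 3 2 isT).

Definition pd (R : realType) (i : 'I_3) (f : R3 R -> R) : R3 R -> R :=
  fun x => 'D_(delta_mx 0 i) f x.

(* Functions on an open set U are represented by total functions, whose values
   outside U are irrelevant to C^k regularity and to derivatives at points
   of U. *)
Fixpoint Ck_on (R : realType) (k : nat) (U : set (R3 R)) (f : R3 R -> R)
    : Prop :=
  (forall x, U x -> {for x, continuous f}) /\
  if k is k'.+1 then
    forall i : 'I_3, (forall x, U x -> derivable f x (delta_mx 0 i)) /\
                     Ck_on k' U (pd i f)
  else True.

Definition smooth_on (R : realType) (U : set (R3 R)) (f : R3 R -> R) : Prop :=
  forall k, Ck_on k U f.

Section Invariants.
Variables (R : realType) (f : R3 R -> R).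

Local Notation f1 i := (pd i f).
Local Notation f2 i j := (pd j (pd i f)).

Definition lapl (x : R3 R) : R := \sum_i f2 i i x.

Definition invJ (x : R3 R) : R := \sum_i f1 i x * f1 i x.

Definition invZ (x : R3 R) : R :=
  \sum_i \sum_j f2 i j x * f1 i x * f1 j x + invJ x * lapl x.

Definition invX (x : R3 R) : R :=
  2 * (\sum_i \sum_j \sum_k f2 i j x * f1 j x * f2 i k x * f1 k x)
  - invJ x * (\sum_j \sum_k f2 j k x * f2 j k x)
  + invJ x * lapl x ^+ 2.

Definition invY (x : R3 R) : R := invZ x ^+ 2 - 2 * invJ x * invX x.

End Invariants.

(* [None] is the point at infinity. *)
Definition sphere_refl (R : realType) (a : R3 R) (r : R)
    (p : one_point_compactification (R3 R)) : one_point_compactification (R3 R) :=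
  match p with
  | None => Some a
  | Some x => if x == a then None
              else Some (a + (r ^+ 2 / dot (x - a) (x - a)) *: (x - a))
  end.

(* Reflection in the plane of equation dot x u = t, completed by infinity. *)
Definition plane_refl (R : realType) (u : R3 R) (t : R)
    (p : one_point_compactification (R3 R)) : one_point_compactification (R3 R) :=
  match p with
  | None => None
  | Some x => Some (x - (2 * (dot x u - t) / dot u u) *: u)
  end.

(* Finite compositions of reflections in spheres and planes; this is the full
   group of conformal transformations, orientation-reversing ones included. *)
Inductive mobius (R : realType) :
    (one_point_compactification (R3 R) -> one_point_compactification (R3 R)) ->
    Prop :=
| mobius_id : mobius id
| mobius_sphere a r Phi :
    0 < r -> mobius Phi -> mobius (sphere_refl a r \o Phi)
| mobius_plane u t Phi :
    u != 0 -> mobius Phi -> mobius (plane_refl u t \o Phi).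

(* A branch of the multivalued function arctan (y3 / y2) off the axis
   y2 = y3 = 0: the equation is tan (h y) = y3 / y2 cleared of denominators,
   so that a branch may cross the half-planes y2 = 0, where the quotient is
   infinite and h y is an odd multiple of pi / 2. *)
Definition arctan_branch (R : realType) (V : set (R3 R)) (h : R3 R -> R) : Prop :=
  forall y, V y -> (crd2 y, crd3 y) != (0, 0) /\
                   crd2 y * sin (h y) = crd3 y * cos (h y).

Definition model_on (R : realType) (V : set (R3 R)) (h : R3 R -> R) : Prop :=
  [\/ forall y, V y -> h y = crd1 y,
      forall y, V y -> y != 0 /\
        h y = ln (crd1 y ^+ 2 + crd2 y ^+ 2 + crd3 y ^+ 2),
      arctan_branch V h
    | forall y, V y -> y != 0 /\
        h y = crd1 y / (crd1 y ^+ 2 + crd2 y ^+ 2 + crd3 y ^+ 2)].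

(* Main.v *)
Require Import Defs.
From mathcomp Require Import all_boot all_order all_algebra.
From mathcomp Require Import all_classical all_reals all_analysis.
From mathcomp Require Import ring lra.
Import Order.TTheory GRing.Theory Num.Theory.
Import numFieldNormedType.Exports.

(** Let J = |df|^2. In an orthonormal frame whose first vector is along df, the
    equations X = Y = 0 say, where J is not zero, that f_22 = f_33 = - f_11 and
    f_23 = 0: they imply Z = 0, and Z^2 - J X is a sum of squares
    ([hessian_identity]). With u = J^(-1/2) this becomes
      u f_ij = - (f_i u_j + f_j u_i) + <df, du> delta_ij          ([hess_f]):
    the one-form df is parallel for the conformal metric J |dx|^2. That metric
    is thus locally the product of a line, with coordinate f, and a surface;
    being conformally flat, it forces the surface to have a constant curvature
    - kappa. In coordinates, exchanging the order of derivatives in [hess_f]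
    gives
      u_ij = tau delta_ij + kappa u f_i f_j                       ([hess_u])
    and once more gives d kappa = 0 ([pd_gkappa]).

    Let Y solve Y'' = - kappa Y. By the two formulas the Hessian of u Y(f) is a
    constant multiple of the identity, so that
      u Y(f) = a + b . x + c |x|^2 / 2,
    whose zero set is a sphere or a plane. Two solutions Y, Z give two such
    functions P, Q, and f is a function of P / Q: its level sets form a pencil
    of spheres. The Lorentzian product b . b' - a c' - a' c of the coefficients
    is kappa Y Z + Y' Z' ([lift_pairing]), which fixes the relative position of
    the two spheres.

    There are no critical points. A quadratic combination of solutions is equal
    to 1 (cos^2 + sin^2, e^t e^(-t) or 1), so u^2 is a polynomial M on the region
    where J is not zero and the coefficients have given values. There J M = 1,
    and this persists at boundary points, where J can therefore not vanish. The
    region is open and closed in the connected set U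
    ([noncritical_of_first_integral]).

    The sign of kappa gives the model. An inversion preserves quadrics up to a
    positive factor and preserves the Lorentzian product ([chart_inversion]).
    - kappa = 0: u is a constant or a multiple of a squared distance; sending its
      zero to infinity makes it constant and makes u f affine, hence f is affine
      and a reflection turns it into a multiple of x_1.
    - kappa = - k^2: each of u e^(k f) and u e^(- k f) is a constant or a multiple
      of a squared distance; sending the zero of the second to infinity and the
      zero of the first to 0 leaves e^(2 k f) equal to a power of |y|.
    - kappa = k^2: u cos(k f) and u sin(k f) vanish on orthogonal spheres, which
      meet; sending a common point to infinity makes them orthogonal planes, and
      two reflections turn these into y_2 = 0 and y_3 = 0, so that k f is, up to
      sign, the angle around the axis y_2 = y_3 = 0. *)

Set Implicit Arguments.
Unset Strict Implicit.
Unset Printing Implicit Defensive.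

Local Open Scope classical_set_scope.
Local Open Scope ring_scope.

(** * Partial derivatives along coordinate lines *)

Local Notation ev i := (delta_mx 0 i : 'rV_3).

Lemma is_derive_line {R : realType} {V : normedModType R} (g : V -> R)
    (x v : V) (t : R) :
  derivable g (x + t *: v) v ->
  is_derive t (1 : R) (fun t => g (x + t *: v)) ('D_v g (x + t *: v)).
Proof.
move=> dg.
have E : (fun h : R => h^-1 *: ((g \o shift (x + t *: v)) (h *: v) - g (x + t *: v)))
   = (fun h : R => h^-1 *: (((fun t => g (x + t *: v)) \o shift t) (h *: 1)
      - g (x + t *: v))).
  apply/funext => h /=; congr (_ *: (g _ - _)).
  by rewrite [h *: 1]mulr1 scalerDl addrCA.
by split; [move: dg; rewrite /derivable E|rewrite /derive E].
Qed.

Lemma is_derive_along {R : realType} {V : normedModType R} (g : V -> R)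
    (x v : V) (d : R) :
  is_derive (0 : R) (1 : R) (fun t => g (x + t *: v)) d -> is_derive x v g d.
Proof.
have E : (fun h : R => h^-1 *: ((g \o shift x) (h *: v) - g x))
   = (fun h : R => h^-1 *: (((fun t => g (x + t *: v)) \o shift 0) (h *: 1)
      - g (x + 0 *: v))).
  apply/funext => h /=; rewrite addr0 [h *: 1]mulr1 scale0r addr0.
  by congr (_ *: (g _ - _)); rewrite addrC.
by move=> [d1 d2]; split; [move: d1; rewrite /derivable E|move: d2; rewrite /derive E].
Qed.

Lemma is_derive_comp1 {R : realType} {V : normedModType R} (G : R -> R)
    (g : V -> R) (x v : V) (dG dg : R) :
  is_derive x v g dg -> is_derive (g x) 1 G dG ->
  is_derive x v (fun y => G (g y)) (dG * dg).
Proof.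
move=> [d1 d2] dG1; apply: is_derive_along.
have Hg : is_derive (0 : R) (1 : R) (fun t => g (x + t *: v)) dg.
  have := @is_derive_line _ _ g x v 0; rewrite scale0r addr0 d2; exact.
have dG2 : is_derive ((fun t => g (x + t *: v)) 0) 1 G dG by rewrite scale0r addr0.
exact: (@is_derive1_comp _ G (fun t => g (x + t *: v)) 0 dG dg).
Qed.

(** The increment is allowed to be negative, which spares a case distinction each
    time a path of coordinate segments is followed. *)
Lemma mvt_line {R : realType} {V : normedModType R} (g : V -> R) (x v : V) (h : R) :
  (forall t, `|t| <= `|h| -> derivable g (x + t *: v) v) ->
  exists2 c, `|c| <= `|h| & g (x + h *: v) - g x = h * 'D_v g (x + c *: v).
Proof.
move=> dg; pose phi t := g (x + t *: v).
have dphi t : `|t| <= `|h| -> is_derive t (1 : R) phi ('D_v g (x + t *: v)).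
  by move=> th; apply/is_derive_line/dg.
have cphi (a b : R) : `|a| <= `|h| -> `|b| <= `|h| ->
    {within `[a, b], continuous phi}.
  move=> ah bh; apply: derivable_within_continuous => t; rewrite in_itv/= => /andP[t1 t2].
  have [] // := dphi t; move: ah bh; rewrite !ler_norml => /andP[a1 a2] /andP[b1 b2].
  by rewrite (le_trans a1 t1) (le_trans t2 b2).
have phi0 : phi 0 = g x by rewrite /phi scale0r addr0.
have [h0|h0] := leP 0 h.
  have [||t] := @MVT_segment _ phi (fun t => 'D_v g (x + t *: v)) 0 h h0.
  - move=> t; rewrite in_itv/= => /andP[t1 t2]; apply: dphi.
    by rewrite !ger0_norm// ltW.
  - by apply: cphi => //; rewrite normr0.
  rewrite in_itv/= => /andP[t1 t2]; rewrite phi0 subr0 => e.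
  by exists t; [rewrite !ger0_norm|rewrite mulrC].
have [||t] := @MVT_segment _ phi (fun t => 'D_v g (x + t *: v)) h 0 (ltW h0).
- move=> t; rewrite in_itv/= => /andP[t1 t2]; apply: dphi.
  by rewrite !ltr0_norm// lerN2 ltW.
- by apply: cphi => //; rewrite normr0.
rewrite in_itv/= => /andP[t1 t2]; rewrite phi0 => e.
exists t; first by rewrite !ler0_norm ?lerN2// ltW.
by rewrite -opprB e; lra.
Qed.

(** * Smooth functions *)

Local Notation i0 := (@Ordinal 3 0 isT).
Local Notation i1 := (@Ordinal 3 1 isT).
Local Notation i2 := (@Ordinal 3 2 isT).

Lemma ord3P (P : 'I_3 -> Prop) : P i0 -> P i1 -> P i2 -> forall i, P i.
Proof.
by move=> p0 p1 p2 [[|[|[|//]]] hi]; [move: p0|move: p1|move: p2];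
  congr (P _); apply: val_inj.
Qed.

Lemma sum3 {R : nmodType} (F : 'I_3 -> R) : \sum_i F i = F i0 + F i1 + F i2.
Proof.
rewrite !big_ord_recr big_ord0 /= add0r.
by congr (F _ + F _ + F _); apply: val_inj.
Qed.

Lemma vec3P {R : nzRingType} (x y : 'rV[R]_3) :
  x 0 i0 = y 0 i0 -> x 0 i1 = y 0 i1 -> x 0 i2 = y 0 i2 -> x = y.
Proof. by move=> h0 h1 h2; apply/rowP; apply: ord3P. Qed.

Lemma ball_rV3P {R : realType} (x y : 'rV[R]_3) (e : R) : 0 < e ->
  ball x e y <-> forall i, `|x 0 i - y 0 i| < e.
Proof.
move=> e0; split; first by move=> [_ h] i; exact: h.
by move=> h; split => // i j; rewrite ord1; exact: h.
Qed.

Lemma ball_step {R : realType} (x y : 'rV[R]_3) (e t : R) (i : 'I_3) : 0 < e ->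
  ball x e y -> `|x 0 i - (y 0 i + t)| < e -> ball x e (y + t *: ev i).
Proof.
move=> e0 /ball_rV3P -/(_ e0) hy ht; apply/ball_rV3P => // j; rewrite !mxE eqxx /=.
by case: eqVneq => [->|_]; rewrite ?mulr1// mulr0 addr0.
Qed.

(** Balls of the sup norm are cubes, so a point of the ball is joined to the centre
    by three coordinate segments inside the ball, along which only partial
    derivatives enter. *)
Lemma grad0_ball {R : realType} (g : 'rV[R]_3 -> R) (x : 'rV[R]_3) (e : R) :
  0 < e ->
  (forall y, ball x e y -> forall i, is_derive y (ev i) g 0) ->
  forall y, ball x e y -> g y = g x.
Proof.
move=> e0 dg y xy.
have step z i : ball x e z -> z 0 i = x 0 i ->
    let z' := z + (y 0 i - x 0 i) *: ev i in ball x e z' /\ g z' = g z.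
  move=> xz zi z'.
  have H t : `|t| <= `|y 0 i - x 0 i| -> ball x e (z + t *: ev i).
    move=> ht; apply: ball_step => //; rewrite zi opprD addNKr normrN.
    apply: le_lt_trans ht _; rewrite distrC.
    by move/ball_rV3P : xy; apply.
  split; first exact: H.
  have [|c hc] := @mvt_line _ _ g z (ev i) (y 0 i - x 0 i).
    by move=> t /H /dg/(_ i)[].
  by have [_ ->] := dg _ (H _ hc) i => /eqP; rewrite mulr0 subr_eq0 => /eqP.
have xx : ball x e x by exact: ballxx.
have [b1 g1] := step x i0 xx erefl.
set z1 := x + _ in b1 g1.
have [|b2 g2] := step z1 i1 b1; first by rewrite !mxE /= mulr0 addr0.
set z2 := z1 + _ in b2 g2.
have [|b3 g3] := step z2 i2 b2; first by rewrite !mxE /= !mulr0 !addr0.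
set z3 := z2 + _ in b3 g3.
suff -> : y = z3 by rewrite g3 g2 g1.
by apply: vec3P; rewrite !mxE /=; ring.
Qed.

Lemma Ck_on_continuous {R : realType} k (U : set 'rV[R]_3) f x :
  Ck_on k U f -> U x -> {for x, continuous f}.
Proof. by case: k => [|k] [c _] Ux; apply: c. Qed.

Lemma Ck_on_sub {R : realType} k (U V : set 'rV[R]_3) f :
  V `<=` U -> Ck_on k U f -> Ck_on k V f.
Proof.
move=> VU; elim: k f => [|k IH] f [c d]; split=> //.
- by move=> x /VU; exact: c.
- by move=> x /VU; exact: c.
- by move=> i; have [d1 /IH d2] := d i; split => // x /VU; exact: d1.
Qed.

Lemma Ck_on_ext {R : realType} k (U : set 'rV[R]_3) (f g : 'rV[R]_3 -> R) :
  open U -> (forall x, U x -> f x = g x) -> Ck_on k U f -> Ck_on k U g.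
Proof.
move=> oU.
have nearU x : U x -> \forall y \near x, U y by move=> Ux; exact: open_nbhs_nbhs.
have cont_fg (f1 g1 : 'rV[R]_3 -> R) :
    (forall x, U x -> f1 x = g1 x) -> (forall x, U x -> {for x, continuous f1}) ->
    forall x, U x -> {for x, continuous g1}.
  move=> fg c x Ux; have : g1 @ x --> f1 x.
    have E : \forall y \near x, f1 y = g1 y.
      by near=> y; apply: fg; near: y; exact: nearU.
    by apply: cvg_trans (c x Ux); exact: (near_eq_cvg E).
  by rewrite (fg x Ux).
elim: k f g => [|k IH] f g fg [c d]; first by split=> //; exact: cont_fg c.
split=> [|i]; first exact: cont_fg c.
have [d1 d2] := d i; split.
  move=> x Ux; apply: near_eq_derivable (d1 x Ux).
  by near=> y; apply: fg; near: y; exact: nearU.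
apply: IH d2 => x Ux; apply: near_eq_derive.
by near=> y; apply: fg; near: y; exact: nearU.
Unshelve. all: by end_near. Qed.

Lemma CkS_on {R : realType} k (U : set 'rV[R]_3) f : Ck_on k.+1 U f -> Ck_on k U f.
Proof.
elim: k f => [|k IH] f [c d]; first by split.
by split=> // i; have [d1 /IH d2] := d i.
Qed.

Lemma pd_eqP {R : realType} (i : 'I_3) (f : 'rV[R]_3 -> R) x d :
  is_derive x (ev i) f d -> pd i f x = d.
Proof. by case. Qed.

Lemma pd_ext {R : realType} (U : set 'rV[R]_3) (f g : 'rV[R]_3 -> R) i x :
  open U -> (forall x, U x -> f x = g x) -> U x -> pd i f x = pd i g x.
Proof.
move=> oU fg Ux; apply: near_eq_derive; near=> y; apply: fg; near: y.
exact: open_nbhs_nbhs.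
Unshelve. all: by end_near. Qed.

Lemma Ck_on_cst {R : realType} k (U : set 'rV[R]_3) (c : R) : Ck_on k U (fun=> c).
Proof.
elim: k c => [|k IH] c; first by split=> // x _; exact: cst_continuous.
split=> [x _|i]; first exact: cst_continuous.
split=> [x _|]; first exact: derivable_cst.
have -> : pd i (fun=> c) = (fun=> 0) :> ('rV[R]_3 -> R); last exact: IH.
by apply/funext => x; exact: derive_cst.
Qed.

Lemma is_derive_coord {R : realType} (i j : 'I_3) (x : 'rV[R]_3) :
  is_derive x (ev i) (fun y : 'rV[R]_3 => y 0 j) (i == j)%:R.
Proof.
apply: is_derive_along.
have -> : (fun t : R => (x + t *: ev i) 0 j) = (fun t => x 0 j + (i == j)%:R * t).
  by apply/funext => t; rewrite !mxE eqxx /= [j == i]eq_sym mulrC.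
have H : is_derive (0 : R) (1 : R) (fun t : R => (i == j)%:R * t) ((i == j)%:R *: 1).
  exact: (@is_deriveZ _ _ _ id (i == j)%:R (0 : R) (1 : R) 1 _).
have H0 : is_derive (0 : R) (1 : R) (cst (x 0 j)) 0 by exact: is_derive_cst.
have H1 := @is_deriveD _ _ _ _ _ _ _ _ _ H0 H.
refine (is_derive_eq H1 _).
by rewrite add0r [_ *: _]mulr1.
Qed.

Lemma Ck_on_coord {R : realType} k (U : set 'rV[R]_3) (j : 'I_3) :
  Ck_on k U (fun y : 'rV[R]_3 => y 0 j).
Proof.
case: k => [|k]; first by split=> // x _; exact: coord_continuous.
split=> [x _|i]; first exact: coord_continuous.
split=> [x _|]; first by case: (is_derive_coord i j x).
have -> : pd i (fun y : 'rV[R]_3 => y 0 j) = (fun=> (i == j)%:R).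
  by apply/funext => x; apply: pd_eqP; exact: is_derive_coord.
exact: Ck_on_cst.
Qed.

Lemma is_derive_add {R : realType} (i : 'I_3) (f g : 'rV[R]_3 -> R) x df dg :
  is_derive x (ev i) f df -> is_derive x (ev i) g dg ->
  is_derive x (ev i) (fun y => f y + g y) (df + dg).
Proof. by move=> h1 h2; exact: is_deriveD. Qed.

Lemma is_derive_mul {R : realType} (i : 'I_3) (f g : 'rV[R]_3 -> R) x df dg :
  is_derive x (ev i) f df -> is_derive x (ev i) g dg ->
  is_derive x (ev i) (fun y => f y * g y) (df * g x + f x * dg).
Proof.
move=> h1 h2; have H := @is_deriveM _ _ _ _ _ _ _ _ h1 h2.
refine (is_derive_eq H _).
by rewrite addrC [_ *: df]mulrC.
Qed.

Lemma Ck_on_is_derive {R : realType} k (U : set 'rV[R]_3) f i x :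
  Ck_on k.+1 U f -> U x -> is_derive x (ev i) f (pd i f x).
Proof. by move=> [_ /(_ i)[d _]] Ux; exact/derivableP/d. Qed.

Lemma Ck_on_add {R : realType} k (U : set 'rV[R]_3) f g : open U ->
  Ck_on k U f -> Ck_on k U g -> Ck_on k U (fun x => f x + g x).
Proof.
move=> oU; elim: k f g => [|k IH] f g Cf Cg.
  by split=> // x Ux; exact: (continuousD (Ck_on_continuous Cf Ux) (Ck_on_continuous Cg Ux)).
split=> [x Ux|i].
  by exact: (continuousD (Ck_on_continuous Cf Ux) (Ck_on_continuous Cg Ux)).
have D x : U x -> is_derive x (ev i) (fun y => f y + g y) (pd i f x + pd i g x).
  by move=> Ux; apply: is_derive_add; [exact: Ck_on_is_derive Cf Ux|exact: Ck_on_is_derive Cg Ux].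
split=> [x /D[]//|]; apply: (@Ck_on_ext _ _ _ (fun x => pd i f x + pd i g x)) => //.
  by move=> x /D /pd_eqP ->.
by apply: IH; [case: Cf => _ /(_ i)[]|case: Cg => _ /(_ i)[]].
Qed.

Lemma Ck_on_mul {R : realType} k (U : set 'rV[R]_3) f g : open U ->
  Ck_on k U f -> Ck_on k U g -> Ck_on k U (fun x => f x * g x).
Proof.
move=> oU; elim: k f g => [|k IH] f g Cf Cg.
  by split=> // x Ux; exact: (continuousM (Ck_on_continuous Cf Ux) (Ck_on_continuous Cg Ux)).
split=> [x Ux|i].
  by exact: (continuousM (Ck_on_continuous Cf Ux) (Ck_on_continuous Cg Ux)).
have D x : U x -> is_derive x (ev i) (fun y => f y * g y) (pd i f x * g x + f x * pd i g x).
  by move=> Ux; apply: is_derive_mul; [exact: Ck_on_is_derive Cf Ux|exact: Ck_on_is_derive Cg Ux].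
split=> [x /D[]//|].
apply: (@Ck_on_ext _ _ _ (fun x => pd i f x * g x + f x * pd i g x)) => //.
  by move=> x /D /pd_eqP ->.
have Cf' : Ck_on k U (pd i f) by case: Cf => _ /(_ i)[].
have Cg' : Ck_on k U (pd i g) by case: Cg => _ /(_ i)[].
by apply: Ck_on_add => //; apply: IH => //; exact: CkS_on.
Qed.

Lemma smooth_cst {R : realType} (U : set 'rV[R]_3) (c : R) : smooth_on U (fun=> c).
Proof. by move=> k; exact: Ck_on_cst. Qed.

Lemma smooth_coord {R : realType} (U : set 'rV[R]_3) j :
  smooth_on U (fun y : 'rV[R]_3 => y 0 j).
Proof. by move=> k; exact: Ck_on_coord. Qed.

Lemma smooth_add {R : realType} (U : set 'rV[R]_3) f g : open U ->
  smooth_on U f -> smooth_on U g -> smooth_on U (fun x => f x + g x).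
Proof. by move=> oU sf sg k; exact: Ck_on_add. Qed.

Lemma smooth_mul {R : realType} (U : set 'rV[R]_3) f g : open U ->
  smooth_on U f -> smooth_on U g -> smooth_on U (fun x => f x * g x).
Proof. by move=> oU sf sg k; exact: Ck_on_mul. Qed.

Lemma smooth_opp {R : realType} (U : set 'rV[R]_3) f : open U ->
  smooth_on U f -> smooth_on U (fun x => - f x).
Proof.
move=> oU sf k; apply: (@Ck_on_ext _ _ _ (fun x => -1 * f x)) => //.
  by move=> x _; rewrite mulN1r.
by apply: Ck_on_mul => //; exact: Ck_on_cst.
Qed.

Lemma smooth_ext {R : realType} (U : set 'rV[R]_3) f g : open U ->
  (forall x, U x -> f x = g x) -> smooth_on U f -> smooth_on U g.
Proof. by move=> oU fg sf k; exact: Ck_on_ext (sf k). Qed.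

Lemma smooth_sum {R : realType} (U : set 'rV[R]_3) (f : 'I_3 -> 'rV[R]_3 -> R) : open U ->
  (forall i, smooth_on U (f i)) -> smooth_on U (fun x => \sum_i f i x).
Proof.
move=> oU sf; apply: (@smooth_ext _ _ (fun x => f i0 x + f i1 x + f i2 x)) => //.
  by move=> x _; rewrite sum3.
by do 2?apply: smooth_add.
Qed.

Lemma smooth_pd {R : realType} (U : set 'rV[R]_3) f i :
  smooth_on U f -> smooth_on U (pd i f).
Proof. by move=> sf k; have [_ /(_ i)[]] := sf k.+1. Qed.

Lemma smooth_sub {R : realType} (U V : set 'rV[R]_3) f :
  V `<=` U -> smooth_on U f -> smooth_on V f.
Proof. by move=> VU sf k; exact: Ck_on_sub (sf k). Qed.

Lemma smooth_is_derive {R : realType} (U : set 'rV[R]_3) f i x :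
  smooth_on U f -> U x -> is_derive x (ev i) f (pd i f x).
Proof. by move=> sf; exact: Ck_on_is_derive (sf 1). Qed.

Lemma smooth_continuous {R : realType} (U : set 'rV[R]_3) f x :
  smooth_on U f -> U x -> {for x, continuous f}.
Proof. by move=> sf; exact: Ck_on_continuous (sf 0). Qed.

(** If the partial derivatives of a function are expressed by smooth operations in
    terms of the function itself, each order of regularity yields the next one. This
    covers inverses and square roots. *)
Lemma smooth_bootstrap {R : realType} (U : set 'rV[R]_3) (h : 'rV[R]_3 -> R)
    (dh : 'I_3 -> 'rV[R]_3 -> R) : open U ->
  (forall x, U x -> {for x, continuous h}) ->
  (forall i x, U x -> is_derive x (ev i) h (dh i x)) ->
  (forall i k, Ck_on k U h -> Ck_on k U (dh i)) -> smooth_on U h.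
Proof.
move=> oU ch Dh Hk; elim=> [|k IH]; first by split.
split=> // i; split=> [x /(Dh i)[]//|].
apply: (@Ck_on_ext _ _ _ (dh i)) => //; last exact: Hk.
by move=> x /(Dh i) /pd_eqP.
Qed.

Lemma smooth_inv {R : realType} (U : set 'rV[R]_3) g : open U ->
  smooth_on U g -> (forall x, U x -> g x != 0) -> smooth_on U (fun x => (g x)^-1).
Proof.
move=> oU sg g0.
apply: (@smooth_bootstrap _ _ _ (fun i x => -1 * ((g x)^-1 * (g x)^-1 * pd i g x))) => //.
- by move=> x Ux; exact: (continuousV (g0 x Ux) (smooth_continuous sg Ux)).
- move=> i x Ux.
  have H := is_derive_comp1 (smooth_is_derive i sg Ux)
    (@is_deriveV R id (g x) 1 1 (g0 x Ux) (is_derive_id _ _)).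
  refine (is_derive_eq H _).
  by rewrite /= -exprVn expr2 [_ *: _]mulr1 mulN1r mulNr.
- move=> i k Ck; apply: Ck_on_mul => //; first exact: Ck_on_cst.
  by apply: Ck_on_mul => //; [exact: Ck_on_mul|exact: smooth_pd].
Qed.

Lemma smooth_comp {R : realType} (U : set 'rV[R]_3) (G : R -> R) (g h : 'rV[R]_3 -> R) :
  open U -> smooth_on U g -> smooth_on U h ->
  (forall x, U x -> {for g x, continuous G}) ->
  (forall x, U x -> is_derive (g x) 1 G (h x)) -> smooth_on U (fun x => G (g x)).
Proof.
move=> oU sg sh cG DG.
apply: (@smooth_bootstrap _ _ _ (fun i x => h x * pd i g x)) => //.
- move=> x Ux; apply: continuous_comp; first exact: (smooth_continuous sg Ux).
  exact: cG.
- move=> i x Ux; apply: is_derive_comp1; last exact: DG.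
  exact: smooth_is_derive sg Ux.
- by move=> i k _; apply: smooth_mul => //; exact: smooth_pd.
Qed.

(** * Symmetry of second derivatives *)

Lemma continuous_near_dist {R : realType} (F : 'rV[R]_3 -> R) x (e : R) : 0 < e ->
  {for x, continuous F} -> \forall y \near x, `|F x - F y| < e.
Proof. by move=> e0 cF; exact: (@cvgr_dist_lt _ _ _ _ _ F _ cF). Qed.

Lemma subrAC4 {R : comNzRingType} (a b c d : R) : a - b - (c - d) = a - c - (b - d).
Proof. ring. Qed.

Lemma dist_halves {R : realFieldType} (a b c e : R) :
  `|a - b| < e / 2 -> `|c - b| < e / 2 -> `|a - c| <= e.
Proof.
rewrite [`|c - b|]distrC => h1 h2; apply: le_trans (ler_distD b _ _) _.
by rewrite ltW// (splitr e) ltrD.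
Qed.

Lemma open_neq0 {R : realType} (U : set 'rV[R]_3) (g : 'rV[R]_3 -> R) : open U ->
  (forall x, U x -> {for x, continuous g}) -> open (U `&` [set x | g x != 0]).
Proof.
move=> oU cg; rewrite openE => x [Ux g0]; apply: filterI; first exact: open_nbhs_nbhs.
have gp : 0 < `|g x| by rewrite normr_gt0; exact: g0.
apply: filterS (continuous_near_dist gp (cg x Ux)) => y /=; apply: contraTneq => ->.
by rewrite subr0 ltxx.
Qed.

(** Applied in the two possible orders, the mean value theorem evaluates one and the
    same second difference as h^2 times either mixed derivative, at points that tend
    to x with h. *)
Lemma schwarz {R : realType} (U : set 'rV[R]_3) f i j x : open U ->
  smooth_on U f -> U x -> pd i (pd j f) x = pd j (pd i f) x.
Proof.
move=> oU sf Ux; have [->//|ij] := eqVneq i j.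
apply/eqP; rewrite eq_sym -subr_eq0; apply/eqP.
pose F y := pd j (pd i f) y; pose G y := pd i (pd j f) y.
have cF : {for x, continuous F}.
  by apply: smooth_continuous Ux; do 2 apply: smooth_pd.
have cG : {for x, continuous G}.
  by apply: smooth_continuous Ux; do 2 apply: smooth_pd.
rewrite -/(F x) -/(G x).
apply/eqP; rewrite -normr_le0; apply/ler_addgt0Pl => e e0; rewrite addr0.
have [r /= r0 hr] : exists2 r : R, 0 < r & forall y, ball x r y ->
    [/\ U y, `|F x - F y| < e / 2 & `|G x - G y| < e / 2].
  have e20 : 0 < e / 2 by rewrite divr_gt0.
  have : \forall y \near x, [/\ U y, `|F x - F y| < e / 2 & `|G x - G y| < e / 2].
    have nF := continuous_near_dist e20 cF.
    have nG := continuous_near_dist e20 cG.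
    have nU : \forall y \near x, U y by exact: open_nbhs_nbhs.
    by apply: filterS3 nU nF nG => y.
  by move/nbhs_ballP => [r r0 hr]; exists r.
(* increments below r / 2 keep x + s e_i + t e_j in the ball of radius r *)
pose h := r / 2.
have h0 : 0 < h by rewrite divr_gt0.
have hr2 : h < r by rewrite /h; lra.
have bxy s t : `|s| <= h -> `|t| <= h -> ball x r (x + s *: ev i + t *: ev j).
  move=> sh th; apply/ball_rV3P => // k; rewrite !mxE eqxx /=.
  have [->|ki] := eqVneq k i.
    rewrite (negbTE ij) mulr1 mulr0 addr0 opprD addNKr normrN.
    exact: le_lt_trans hr2.
  rewrite mulr0 addr0; case: (k == j); last by rewrite mulr0 addr0 subrr normr0.
  by rewrite mulr1 opprD addNKr normrN; exact: le_lt_trans hr2.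
have nh : `|h| = h by rewrite gtr0_norm.
have nhle : `|h| <= h by rewrite nh.
have dU (g : 'rV[R]_3 -> R) l y : smooth_on U g -> U y -> derivable g y (ev l).
  by move=> sg Uy; case: (@smooth_is_derive _ _ _ l _ sg Uy).
(* the second difference, by the mean value theorem in direction a, then in direction b *)
have key (a b : 'I_3) : (forall s t, `|s| <= h -> `|t| <= h ->
      ball x r (x + s *: ev a + t *: ev b)) ->
    exists2 y, ball x r y & f (x + h *: ev a + h *: ev b) - f (x + h *: ev a)
       - (f (x + h *: ev b) - f x) = h * (h * pd b (pd a f) y).
  move=> bab.
  have bba s t : `|s| <= h -> `|t| <= h -> ball x r (x + t *: ev b + s *: ev a).
    by move=> sh th; rewrite addrAC; exact: bab.
  pose phi y := f (y + h *: ev b) - f y.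
  have bs0 s : `|s| <= h -> ball x r (x + s *: ev a).
    by move=> sh; have := bab s 0 sh; rewrite normr0 scale0r addr0; apply; exact: ltW.
  have Dphi s : `|s| <= h -> is_derive (x + s *: ev a) (ev a) phi
      (pd a f (x + s *: ev a + h *: ev b) - pd a f (x + s *: ev a)).
    move=> sh; apply: is_deriveB.
      have [U1 _ _] := hr _ (bab s h sh nhle).
      have := @smooth_is_derive _ _ _ a _ sf U1.
      move=> D1; apply: is_derive_along.
      have := @is_derive_line _ _ f (x + s *: ev a + h *: ev b) (ev a) 0.
      rewrite scale0r addr0 => /(_ _) H.
      have -> : (fun t : R => f (x + s *: ev a + t *: ev a + h *: ev b)) =
        (fun t => f (x + s *: ev a + h *: ev b + t *: ev a)).
        by apply/funext => t; rewrite addrAC.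
      by apply: H; case: D1.
    by apply: smooth_is_derive sf _; have [] := hr _ (bs0 s sh).
  have [|s sh] := @mvt_line _ _ phi x (ev a) h.
    by move=> t; rewrite nh => /Dphi[].
  rewrite nh in sh; have [_ ->] := Dphi s sh.
  have [|t th] := @mvt_line _ _ (pd a f) (x + s *: ev a) (ev b) h.
    move=> t; rewrite nh => th; apply: dU; first exact: smooth_pd.
    by have [] := hr _ (bab s t sh th).
  rewrite nh in th => -> e1; exists (x + s *: ev a + t *: ev b); first exact: bab.
  by rewrite -e1 /phi.
have [y1 b1 e1] := key i j bxy.
have [|y2 b2 e2] := key j i; first by move=> s t sh th; rewrite addrAC; exact: bxy.
have FG : F y1 = G y2.
  have : h * (h * F y1) = h * (h * G y2).
    apply: (etrans (esym e1)); apply: (etrans _ e2).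
    by rewrite [x + h *: ev j + _]addrAC subrAC4.
  by move/(mulfI (lt0r_neq0 h0))/(mulfI (lt0r_neq0 h0)).
have [_ f1 _] := hr _ b1; have [_ _] := hr _ b2.
by rewrite -FG; exact: dist_halves f1.
Qed.

(** * Pointwise tensor algebra *)
Local Opaque pd.

Lemma sum_sq_eq0 {R : realDomainType} (b : 'I_3 -> R) :
  \sum_i b i * b i = 0 -> forall i, b i = 0.
Proof.
move=> /eqP; rewrite psumr_eq0; last by move=> k _; rewrite -expr2 sqr_ge0.
move=> /allP h i; have := h i; rewrite mem_index_enum => /(_ isT) /implyP /(_ isT).
by rewrite mulf_eq0 orbb => /eqP.
Qed.

(** In a frame with f = (f_1, 0, 0) the summand vanishes if i or j is the first index
    and is otherwise J (h_ij + h_11 delta_ij), and the identity is a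
    direct expansion. *)
Lemma hessian_identity {R : comNzRingType} (f : 'I_3 -> R) (H : 'I_3 -> 'I_3 -> R) :
  (forall i j, H i j = H j i) ->
  let J := \sum_i f i * f i in
  let L := \sum_i H i i in
  let w i := \sum_j H i j * f j in
  let Z := \sum_i \sum_j H i j * f i * f j + J * L in
  let X := 2 * (\sum_i \sum_j \sum_k H i j * f j * H i k * f k)
           - J * (\sum_j \sum_k H j k * H j k) + J * L ^+ 2 in
  \sum_i \sum_j (J * H i j - f i * w j - f j * w i
                 + (\sum_k f k * w k) * (i == j)%:R) ^+ 2 = Z ^+ 2 - J * X.
Proof.
move=> sH /=; rewrite !sum3 /= !(sH i1 i0) !(sH i2 i0) !(sH i2 i1).
move: (f i0) (f i1) (f i2) (H i0 i0) (H i0 i1) (H i0 i2) (H i1 i1) (H i1 i2) (H i2 i2).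
move=> a b c h00 h01 h02 h11 h12 h22; ring.
Qed.

(** The hypothesis is the integrability condition of [hess_f]. Contracting it with f,
    and taking its trace, gives two relations between the vectors s and N f modulo f;
    together they force s to be proportional to f. Then N - t delta is a symmetric
    matrix whose rows are all proportional to f. *)
Lemma codazzi_rank1 {R : fieldType} (f s : 'I_3 -> R) (N : 'I_3 -> 'I_3 -> R)
    (J := \sum_i f i * f i) (t := - (\sum_i s i * f i) / J) :
  (forall i j, N i j = N j i) -> J != 0 ->
  (forall i j k, f k * N i j - f j * N i k + s k * (i == j)%:R - s j * (i == k)%:R = 0) ->
  (forall k, s k = - t * f k) /\
  exists m, forall i j, N i j = t * (i == j)%:R + m * f i * f j.
Proof.
move=> sN J0 hE.
pose E i j k := f k * N i j - f j * N i k + s k * (i == j)%:R - s j * (i == k)%:R.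
have key j k : s k * f j - s j * f k = f j * (\sum_i E i i k) - f k * (\sum_i E i i j)
    - \sum_i f i * E i j k.
  by move: j k; apply: ord3P; apply: ord3P; rewrite !sum3 /E /=
    ?(sN i1 i0) ?(sN i2 i0) ?(sN i2 i1); ring.
have sf j k : s k * f j = s j * f k.
  apply/eqP; rewrite -subr_eq0 key.
  by rewrite !big1 ?mulr0 ?subr0// => i _; rewrite ?[E _ _ _]hE ?mulr0.
have st k : s k = - t * f k.
  have Js : J * s k = (\sum_i s i * f i) * f k.
    rewrite !mulr_suml; apply: eq_bigr => i _.
    by rewrite -!mulrA [f i * s k]mulrC sf mulrCA.
  apply: (mulfI J0); rewrite Js /t; move: (\sum__ _) => a; by field.
split=> //.
pose M i j := N i j - t * (i == j)%:R.
have MC i j : M i j = M j i by rewrite /M sN eq_sym.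
have Mf i j k : f k * M i j = f j * M i k.
  apply/eqP; rewrite -subr_eq0 -(hE i j k) !st /M; apply/eqP; ring.
pose n i := \sum_k f k * M i k.
have Mn i j : J * M i j = f j * n i.
  rewrite /J /n mulr_suml mulr_sumr; apply: eq_bigr => k _.
  by rewrite -mulrA Mf mulrCA.
have nf i j : f j * n i = f i * n j by rewrite -!Mn MC.
have Jn i : J * n i = f i * \sum_j f j * n j.
  rewrite /J mulr_suml mulr_sumr; apply: eq_bigr => k _.
  by rewrite -mulrA nf mulrCA.
exists ((\sum_j f j * n j) / J / J) => i j.
apply/eqP; rewrite addrC -subr_eq -/(M i j); apply/eqP.
apply: (mulfI J0); apply: (mulfI J0); rewrite Mn mulrCA Jn.
by move: (\sum__ _) => a; field.
Qed.

(** As for [codazzi_rank1], the contraction with f and the trace are compared: they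
    show that K is proportional to f, after which the trace leaves only T. *)
Lemma codazzi_vanish {R : realFieldType} (f T K : 'I_3 -> R) (u : R)
    (J := \sum_i f i * f i) :
  J != 0 -> u != 0 ->
  (forall i j k, T k * (i == j)%:R - T j * (i == k)%:R
                 + u * f i * (K k * f j - K j * f k) = 0) ->
  forall k, T k = 0.
Proof.
move=> J0 u0 hE.
pose E i j k := T k * (i == j)%:R - T j * (i == k)%:R
                 + u * f i * (K k * f j - K j * f k).
have key j k : u * J * (K k * f j - K j * f k)
   = 2 * (\sum_i f i * E i j k) - (f j * (\sum_i E i i k) - f k * (\sum_i E i i j)).
  by move: j k; apply: ord3P; apply: ord3P; rewrite /J !sum3 /E /=; ring.
have Kf j k : K k * f j - K j * f k = 0.
  apply: (mulfI J0); apply: (mulfI u0); rewrite !mulr0 mulrA key.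
  by rewrite !big1 ?mulr0 ?subr0// => i _; rewrite ?[E _ _ _]hE ?mulr0.
move=> k; have : \sum_i E i i k = 0 by rewrite big1// => i _; exact: hE.
have -> : \sum_i E i i k = 2 * T k.
  rewrite (eq_bigr (fun i => T k - T i * (i == k)%:R)).
    by move: k; apply: ord3P; rewrite !sum3 /=; ring.
  by move=> i _; rewrite /E Kf mulr0 addr0 eqxx mulr1.
by move/eqP; rewrite mulf_eq0 pnatr_eq0 /= => /eqP.
Qed.

(** * The parallel gradient and its integrability conditions *)

Lemma is_derive_opp {R : realType} (i : 'I_3) (f : 'rV[R]_3 -> R) x df :
  is_derive x (ev i) f df -> is_derive x (ev i) (fun y => - f y) (- df).
Proof. by move=> h1; exact: is_deriveN. Qed.

Lemma is_derive_cstf {R : realType} (i : 'I_3) (c : R) (x : 'rV[R]_3) :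
  is_derive x (ev i) (fun=> c) 0.
Proof. exact: is_derive_cst. Qed.

Lemma is_derive_sum3 {R : realType} (i : 'I_3) (F : 'I_3 -> 'rV[R]_3 -> R) x dF :
  (forall j, is_derive x (ev i) (F j) (dF j)) ->
  is_derive x (ev i) (fun y => \sum_j F j y) (\sum_j dF j).
Proof.
move=> h; rewrite sum3.
have -> : (fun y => \sum_j F j y) = (fun y => F i0 y + F i1 y + F i2 y).
  by apply/funext => y; rewrite sum3.
by apply: is_derive_add => //; apply: is_derive_add.
Qed.

Lemma is_derive_unique {R : realType} (U : set 'rV[R]_3) (i : 'I_3)
    (f g : 'rV[R]_3 -> R) x df dg : open U -> U x -> (forall y, U y -> f y = g y) ->
  is_derive x (ev i) f df -> is_derive x (ev i) g dg -> df = dg.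
Proof.
move=> oU Ux fg /pd_eqP <- /pd_eqP <-; exact: (pd_ext i oU fg Ux).
Qed.

(** The next four lemmas are the scalar computations behind the tensor identities
    below. They are stated with variables in place of partial derivatives, whose
    definition is costly to compare. *)
Lemma hess_f_alg {R : fieldType} (J h a b wi wj m d v ui uj g : R) : J != 0 ->
  J * h - a * wj - b * wi + m * d = 0 -> J * g = - v * m ->
  J * ui = - v * wi -> J * uj = - v * wj ->
  v * h = - (a * uj + b * ui) + g * d.
Proof.
move=> J0 E Hg Hi Hj; apply: (mulfI J0).
have -> : J * (- (a * uj + b * ui) + g * d) = - (a * (J * uj) + b * (J * ui)) + (J * g) * d.
  by ring.
rewrite Hi Hj Hg.
have -> : J * (v * h) = v * (J * h - a * wj - b * wi + m * d) + v * (a * wj + b * wi - m * d).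
  by ring.
by rewrite E; ring.
Qed.

Lemma codazzi_u_alg {R : realFieldType} (uk uj ui u hij hik hjk hijk fi fj fk ujk
    uik uij sk sj g dij dik : R) :
  uk * hij + u * hijk = - (hik * uj + fi * ujk + (hjk * ui + fj * uik))
    + (sk * dij + g * 0) ->
  uj * hik + u * hijk = - (hij * uk + fi * ujk + (hjk * ui + fk * uij))
    + (sj * dik + g * 0) ->
  fk * uij - fj * uik + sk * dij - sj * dik = 0.
Proof. by move=> D1 D2; lra. Qed.

Lemma gkappa_alg {R : comNzRingType} (a b c d e m : R) :
  e * (- c * d) = d * (e * c + e * m * b - a) -> d * d * (a - 2 * e * c - e * m * b) = 0.
Proof.
move=> h; have -> : d * d * (a - 2 * e * c - e * m * b)
    = d * (e * (- c * d) - d * (e * c + e * m * b - a)) by ring.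
by rewrite h subrr mulr0.
Qed.

Lemma gtau_alg {R : comNzRingType}
    (z tk tj g Kk Kj K u ui uj uk fi fj fk hij hik hjk dij dik t : R) :
  z = tk * dij + t * 0 + (((Kk * u + K * uk) * fi + K * u * hik) * fj + K * u * fi * hjk) ->
  z = tj * dik + t * 0 + (((Kj * u + K * uj) * fi + K * u * hij) * fk + K * u * fi * hjk) ->
  u * hij = - (fi * uj + fj * ui) + g * dij ->
  u * hik = - (fi * uk + fk * ui) + g * dik ->
  (tk - K * g * fk) * dij - (tj - K * g * fj) * dik + u * fi * (Kk * fj - Kj * fk) = 0.
Proof.
move=> D1 D2 H1 H2.
have -> : (tk - K * g * fk) * dij - (tj - K * g * fj) * dik + u * fi * (Kk * fj - Kj * fk)
  = (tk * dij + t * 0 + (((Kk * u + K * uk) * fi + K * u * hik) * fj + K * u * fi * hjk))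
  - (tj * dik + t * 0 + (((Kj * u + K * uj) * fi + K * u * hij) * fk + K * u * fi * hjk))
  + K * fk * (u * hij) - K * fk * g * dij - K * fj * (u * hik) + K * fj * g * dik
  - K * uk * fi * fj + K * uj * fi * fk by ring.
by rewrite -D1 -D2 H1 H2; ring.
Qed.

Section Structure.
Variables (R : realType) (W : set 'rV[R]_3) (f u : 'rV[R]_3 -> R).
Hypotheses (oW : open W) (sf : smooth_on W f) (su : smooth_on W u).
Hypothesis uJ : forall x, W x -> u x ^+ 2 * invJ f x = 1.

Local Notation f1 i := (pd i f).
Local Notation f2 i j := (pd j (pd i f)).
Local Notation u1 i := (pd i u).
Local Notation u2 i j := (pd j (pd i u)).

Let sf1 i : smooth_on W (f1 i). Proof. exact: smooth_pd. Qed.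
Let sf2 i j : smooth_on W (f2 i j). Proof. exact: smooth_pd. Qed.
Let su1 i : smooth_on W (u1 i). Proof. exact: smooth_pd. Qed.
Let su2 i j : smooth_on W (u2 i j). Proof. exact: smooth_pd. Qed.

Let f2C i j x : W x -> f2 i j x = f2 j i x. Proof. exact: schwarz. Qed.
Let u2C i j x : W x -> u2 i j x = u2 j i x. Proof. exact: schwarz. Qed.

Let J0 x : W x -> invJ f x != 0.
Proof.
move=> Wx; apply/eqP => j0; have := uJ Wx; rewrite j0 mulr0 => /eqP.
by rewrite eq_sym oner_eq0.
Qed.

Let u0 x : W x -> u x != 0.
Proof.
move=> Wx; apply/eqP => j0; have := uJ Wx; rewrite j0 expr0n mul0r => /eqP.
by rewrite eq_sym oner_eq0.
Qed.

Lemma invJ_inv x : W x -> (invJ f x)^-1 = u x ^+ 2.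
Proof. by move=> Wx; apply: (mulIf (J0 Wx)); rewrite mulVf ?J0// uJ. Qed.

Lemma pd_u x i : W x -> invJ f x * u1 i x = - u x * \sum_j f2 i j x * f1 j x.
Proof.
move=> Wx.
have D1 : is_derive x (ev i) (fun y => u y * u y * invJ f y)
   ((u1 i x * u x + u x * u1 i x) * invJ f x
    + u x * u x * \sum_j (f2 j i x * f1 j x + f1 j x * f2 j i x)).
  apply: is_derive_mul.
    by apply: is_derive_mul; apply: smooth_is_derive Wx.
  apply: is_derive_sum3 => j; apply: is_derive_mul; exact: smooth_is_derive Wx.
have := is_derive_unique oW Wx _ D1 (is_derive_cstf i 1 x).
move=> /(_ (fun y Wy => uJ Wy)).
have -> : \sum_j (f2 j i x * f1 j x + f1 j x * f2 j i x) = 2 * \sum_j f2 i j x * f1 j x.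
  rewrite mulr_sumr; apply: eq_bigr => j _; rewrite (f2C j i Wx).
  by move: (f2 i j x) (f1 j x) => a b; ring.
move: (\sum__ _) => w e; apply: (mulfI (u0 Wx)).
move: e; move: (u1 i x) (u x) (invJ f x) => a b c e; lra.
Qed.

Definition gdot x := \sum_i f1 i x * u1 i x.

Hypotheses (X0 : forall x, W x -> invX f x = 0) (Y0 : forall x, W x -> invY f x = 0).

(** The tensor in [hessian_identity] vanishes; by [pd_u] its vector w, the product of
    the Hessian of f with df, is - J du / u. *)
Lemma hess_f x i j : W x ->
  u x * f2 i j x = - (f1 i x * u1 j x + f1 j x * u1 i x) + gdot x * (i == j)%:R.
Proof.
move=> Wx.
have Z0 : invZ f x = 0.
  have := Y0 Wx; rewrite /invY X0// mulr0 subr0 => /eqP.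
  by rewrite expf_eq0 /= => /eqP.
have := hessian_identity (fun i => f1 i x) (fun i j => f2C i j Wx).
cbv zeta; rewrite -/(invJ f x) -/(lapl f x) -/(invZ f x) -/(invX f x) Z0 X0//.
rewrite mulr0 subr0 expr0n /= => /eqP.
rewrite psumr_eq0; last by move=> k _; apply: sumr_ge0 => l _; exact: sqr_ge0.
move=> /allP /(_ i); rewrite mem_index_enum => /(_ isT) /implyP /(_ isT).
rewrite psumr_eq0; last by move=> k _; exact: sqr_ge0.
move=> /allP /(_ j); rewrite mem_index_enum => /(_ isT) /implyP /(_ isT).
rewrite expf_eq0 /= => /eqP E.
have Hg : invJ f x * gdot x = - u x * \sum_k f1 k x * \sum_l f2 k l x * f1 l x.
  rewrite /gdot !mulr_sumr; apply: eq_bigr => k _.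
  by rewrite mulrCA pd_u// mulrCA.
have Hi := pd_u i Wx; have Hj := pd_u j Wx.
exact: (hess_f_alg (J0 Wx) E Hg Hi Hj).
Qed.

Lemma smooth_gdot : smooth_on W gdot.
Proof. by apply: smooth_sum => // i; exact: smooth_mul. Qed.

Let sg := smooth_gdot.

(** The coefficient of delta_ij in the Hessian of u, the factor u^2 standing for 1 / J;
    [gkappa] is that of u f_i f_j, see [hess_u]. *)
Definition gtau x := - (\sum_i pd i gdot x * f1 i x) * u x ^+ 2.
Definition gkappa x := (\sum_i u1 i x ^+ 2) - 2 * u x * gtau x.

Lemma smooth_gtau : smooth_on W gtau.
Proof.
apply: smooth_mul => //; last exact: smooth_mul.
apply: smooth_opp => //; apply: smooth_sum => // i; apply: smooth_mul => //.
exact: smooth_pd.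
Qed.

Let st := smooth_gtau.

Lemma smooth_gkappa : smooth_on W gkappa.
Proof.
apply: smooth_add => //.
  by apply: smooth_sum => // i; exact: smooth_mul.
apply: smooth_opp => //; apply: smooth_mul => //; apply: smooth_mul => //.
exact: smooth_cst.
Qed.

Let sk := smooth_gkappa.

(** The terms with third derivatives of f, and those with second derivatives of f
    multiplied by du, cancel when the derivative of [hess_f] is made antisymmetric in
    its last two indices. *)
Lemma codazzi_u x i j k : W x ->
  f1 k x * u2 i j x - f1 j x * u2 i k x + pd k gdot x * (i == j)%:R
  - pd j gdot x * (i == k)%:R = 0.
Proof.
move=> Wx.
have D m l : u1 l x * f2 i m x + u x * pd l (f2 i m) x
   = - ((f2 i l x * u1 m x + f1 i x * u2 m l x) + (f2 m l x * u1 i x + f1 m x * u2 i l x))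
     + (pd l gdot x * (i == m)%:R + gdot x * 0).
  apply: (@is_derive_unique _ _ l (fun y => u y * f2 i m y)
    (fun y => - (f1 i y * u1 m y + f1 m y * u1 i y) + gdot y * (i == m)%:R)
    _ _ _ oW Wx).
  - by move=> y Wy; exact: hess_f.
  - by apply: is_derive_mul; apply: smooth_is_derive Wx.
  - apply: is_derive_add.
      apply: is_derive_opp; apply: is_derive_add; apply: is_derive_mul;
      exact: smooth_is_derive Wx.
    exact: (is_derive_mul (smooth_is_derive l smooth_gdot Wx) (is_derive_cstf l _ x)).
have D1 := D j k; have D2 := D k j.
rewrite (schwarz k j oW (sf1 i) Wx) (u2C j k Wx) (f2C j k Wx) in D1.
exact: (codazzi_u_alg D1 D2).
Qed.

Lemma gtauE x : W x -> gtau x = - (\sum_i pd i gdot x * f1 i x) / \sum_i f1 i x * f1 i x.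
Proof. by move=> Wx; rewrite -/(invJ f x) invJ_inv. Qed.

Lemma pd_gdot x k : W x -> pd k gdot x = - gtau x * f1 k x.
Proof.
move=> Wx; have [H _] := codazzi_rank1 (fun i j => u2C i j Wx) (J0 Wx)
  (fun i j k => codazzi_u i j k Wx).
by rewrite gtauE.
Qed.

(** [codazzi_rank1] gives the shape of the Hessian with an unknown coefficient m. It is
    found by expanding the derivative of <df, du> and comparing with [pd_gdot]. *)
Lemma hess_u x i j : W x ->
  u2 i j x = gtau x * (i == j)%:R + gkappa x * u x * f1 i x * f1 j x.
Proof.
move=> Wx; have [_] := codazzi_rank1 (fun i j => u2C i j Wx) (J0 Wx)
  (fun i j k => codazzi_u i j k Wx).
rewrite -gtauE// => -[m hm]; rewrite hm.
suff -> : m = gkappa x * u x by [].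
have H k : u x * pd k gdot x = f1 k x * (u x * gtau x + u x * m * invJ f x - \sum_i u1 i x ^+ 2).
  have -> : pd k gdot x = \sum_i (f2 i k x * u1 i x + f1 i x * u2 i k x).
    apply: pd_eqP; apply: is_derive_sum3 => l.
    apply: is_derive_mul; exact: smooth_is_derive Wx.
  rewrite mulr_sumr (eq_bigr (fun i =>
    (- (f1 i x * u1 k x + f1 k x * u1 i x) + gdot x * (i == k)%:R) * u1 i x
    + u x * f1 i x * (gtau x * (i == k)%:R + m * f1 i x * f1 k x))); last first.
    by move=> l _; rewrite mulrDr mulrA hess_f// hm mulrA.
  rewrite /gdot /invJ !sum3; move: k; apply: ord3P; rewrite /=;
  move: (f1 i0 x) (f1 i1 x) (f1 i2 x) (u1 i0 x) (u1 i1 x) (u1 i2 x) (u x) (gtau x) => *; ring.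
have E : invJ f x * (gkappa x - u x * m * invJ f x) = 0.
  rewrite {1}/invJ mulr_suml big1// => k _.
  have := H k; rewrite pd_gdot// /gkappa.
  by move=> h; exact: (gkappa_alg h).
move/eqP: E; rewrite mulf_eq0 (negbTE (J0 Wx)) /= subr_eq0 => /eqP ->.
have := uJ Wx; move: (u x) (invJ f x) => a b e.
have -> : a * m * b * a = m * (a ^+ 2 * b) by ring.
by rewrite e mulr1.
Qed.

(** The antisymmetric part of the derivative of [hess_u] has the form required by
    [codazzi_vanish]. *)
Lemma pd_gtau x k : W x -> pd k gtau x = gkappa x * gdot x * f1 k x.
Proof.
move=> Wx; apply/eqP; rewrite -subr_eq0; apply/eqP.
apply: (@codazzi_vanish _ (fun i => f1 i x) (fun k => pd k gtau x - gkappa x * gdot x * f1 k x)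
   (fun k => pd k gkappa x) (u x) (J0 Wx) (u0 Wx)) => {k} i j k.
have D m l : pd l (u2 i m) x = (pd l gtau x * (i == m)%:R + gtau x * 0)
   + (((pd l gkappa x * u x + gkappa x * u1 l x) * f1 i x + gkappa x * u x * f2 i l x) * f1 m x
      + gkappa x * u x * f1 i x * f2 m l x).
  apply: (@is_derive_unique _ _ l (u2 i m)
    (fun x => gtau x * (i == m)%:R + gkappa x * u x * f1 i x * f1 m x) _ _ _ oW Wx).
  - by move=> y Wy; exact: hess_u.
  - exact: smooth_is_derive Wx.
  - apply: is_derive_add.
      exact: (is_derive_mul (smooth_is_derive l smooth_gtau Wx) (is_derive_cstf l _ x)).
    apply: is_derive_mul; last exact: smooth_is_derive Wx.
    apply: is_derive_mul; last exact: smooth_is_derive Wx.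
    by apply: is_derive_mul; exact: smooth_is_derive Wx.
have D1 := D j k; have D2 := D k j.
rewrite (schwarz k j oW (su1 i) Wx) (f2C j k Wx) in D1.
exact: (gtau_alg D1 D2 (hess_f i j Wx) (hess_f i k Wx)).
Qed.

Lemma pd_gkappa x k : W x -> pd k gkappa x = 0.
Proof.
move=> Wx.
have D : pd k gkappa x = (\sum_i (u2 i k x * u1 i x + u1 i x * u2 i k x))
   + - ((0 * u x + 2 * u1 k x) * gtau x + 2 * u x * pd k gtau x).
  apply: pd_eqP; apply: is_derive_add.
    apply: is_derive_sum3 => l; apply: is_derive_mul; exact: smooth_is_derive Wx.
  apply: is_derive_opp; apply: is_derive_mul; last exact: smooth_is_derive Wx.
  exact: (is_derive_mul (is_derive_cstf k _ x) (smooth_is_derive k su Wx)).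
rewrite D pd_gtau// (eq_bigr (fun i =>
  2 * u1 i x * (gtau x * (i == k)%:R + gkappa x * u x * f1 i x * f1 k x))); last first.
  by move=> l _; rewrite hess_u//; move: (gtau x) => t; ring.
rewrite /gdot !sum3; move: (gkappa x) (gtau x) => K t; move: k {D}; apply: ord3P; rewrite /=;
  move: (f1 i0 x) (f1 i1 x) (f1 i2 x) (u1 i0 x) (u1 i1 x) (u1 i2 x) (u x) => *; ring.
Qed.

End Structure.

(** * Quadrics from solutions of Y'' = - kappa Y *)

Local Notation quad R := (R * ('I_3 -> R) * R)%type.

(** A triple (a, b, c) stands for the function a + b . x + c |x|^2 / 2, whose zero set
    is a sphere, a plane, a point or empty. *)
Definition quadric {R : realType} (p : quad R) (x : 'rV[R]_3) : R :=
  p.1.1 + \sum_i p.1.2 i * x 0 i + p.2 / 2 * \sum_i x 0 i ^+ 2.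

(** The Lorentzian form for which spheres correspond to vectors of positive square and
    points to isotropic vectors. *)
Definition pairing {R : realType} (p q : quad R) : R :=
  \sum_i p.1.2 i * q.1.2 i - p.1.1 * q.2 - q.1.1 * p.2.

Definition ode {R : realType} (k0 : R) (Y Y1 : R -> R) :=
  (forall t, is_derive t (1 : R) Y (Y1 t)) /\ (forall t, is_derive t (1 : R) Y1 (- k0 * Y t)).

Section Lift.
Variables (R : realType) (f u : 'rV[R]_3 -> R) (Y Y1 : R -> R).

(** [lift_d] is the gradient of u Y(f) and [lift_c] the factor of delta_ij in its
    Hessian; the remaining two coefficients are read off by Taylor expansion. *)
Definition lift_c (x : 'rV[R]_3) := gtau f u x * Y (f x) + gdot f u x * Y1 (f x).
Definition lift_d i (x : 'rV[R]_3) := pd i u x * Y (f x) + u x * (Y1 (f x) * pd i f x).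
Definition lift_b i (x : 'rV[R]_3) := lift_d i x - lift_c x * x 0 i.
Definition lift_a (x : 'rV[R]_3) :=
  u x * Y (f x) - \sum_i lift_b i x * x 0 i - lift_c x / 2 * \sum_i x 0 i ^+ 2.

Definition lift_coef (x : 'rV[R]_3) : quad R := (lift_a x, lift_b ^~ x, lift_c x).

Lemma lift_coefE x : u x * Y (f x) = quadric (lift_coef x) x.
Proof. by rewrite /quadric /lift_coef /= /lift_a; ring. Qed.

Variables (W : set 'rV[R]_3) (k0 : R).
Hypotheses (oW : open W) (sf : smooth_on W f) (su : smooth_on W u).
Hypothesis uJ : forall x, W x -> u x ^+ 2 * invJ f x = 1.
Hypotheses (X0 : forall x, W x -> invX f x = 0) (Y0 : forall x, W x -> invY f x = 0).
Hypothesis odeY : ode k0 Y Y1.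

Let DY x k : W x -> is_derive x (ev k) (fun y => Y (f y)) (Y1 (f x) * pd k f x).
Proof. by move=> Wx; apply: is_derive_comp1; [exact: smooth_is_derive Wx|case: odeY]. Qed.

Let DY1 x k : W x -> is_derive x (ev k) (fun y => Y1 (f y)) (- k0 * Y (f x) * pd k f x).
Proof. by move=> Wx; apply: is_derive_comp1; [exact: smooth_is_derive Wx|case: odeY]. Qed.

Lemma is_derive_lift_c x k : W x -> gkappa f u x = k0 -> is_derive x (ev k) lift_c 0.
Proof.
move=> Wx kx.
have H : is_derive x (ev k) lift_c
  ((pd k (gtau f u) x * Y (f x) + gtau f u x * (Y1 (f x) * pd k f x))
   + (pd k (gdot f u) x * Y1 (f x) + gdot f u x * (- k0 * Y (f x) * pd k f x))).
  apply: is_derive_add.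
    exact: (is_derive_mul (smooth_is_derive k (smooth_gtau oW sf su) Wx) (DY k Wx)).
  exact: (is_derive_mul (smooth_is_derive k (smooth_gdot oW sf su) Wx) (DY1 k Wx)).
refine (is_derive_eq H _).
rewrite (pd_gtau oW sf su uJ X0 Y0)// (pd_gdot oW sf su uJ X0 Y0)// kx; ring.
Qed.

Lemma is_derive_lift_d x k i : W x -> gkappa f u x = k0 ->
  is_derive x (ev k) (lift_d i) (lift_c x * (i == k)%:R).
Proof.
move=> Wx kx.
have su1 := smooth_pd i su; have sf1 := smooth_pd i sf.
have H := is_derive_add (is_derive_mul (smooth_is_derive k su1 Wx) (DY k Wx))
  (is_derive_mul (smooth_is_derive k su Wx)
    (is_derive_mul (DY1 k Wx) (smooth_is_derive k sf1 Wx))).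
refine (is_derive_eq H _).
have E := hess_f oW sf su uJ X0 Y0 i k Wx.
have -> : u x * (- k0 * Y (f x) * pd k f x * pd i f x + Y1 (f x) * pd k (pd i f) x) =
  - u x * k0 * Y (f x) * pd k f x * pd i f x + Y1 (f x) * (u x * pd k (pd i f) x) by ring.
rewrite E (hess_u oW sf su uJ X0 Y0)// kx /lift_c; ring.
Qed.

Lemma is_derive_lift_b x k i : W x -> gkappa f u x = k0 -> is_derive x (ev k) (lift_b i) 0.
Proof.
move=> Wx kx.
have H := is_derive_add (is_derive_lift_d k i Wx kx) (is_derive_opp (is_derive_mul
   (is_derive_lift_c k Wx kx) (is_derive_coord k i x))).
refine (is_derive_eq H _).
by rewrite mul0r add0r [k == i]eq_sym subrr.
Qed.

Lemma is_derive_lift_a x k : W x -> gkappa f u x = k0 -> is_derive x (ev k) lift_a 0.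
Proof.
move=> Wx kx.
have Dc := is_derive_lift_c k Wx kx.
have Hb := is_derive_sum3 (fun i => is_derive_mul (is_derive_lift_b k i Wx kx) (is_derive_coord k i x)).
have Hq := is_derive_sum3 (fun i => is_derive_mul (is_derive_coord k i x) (is_derive_coord k i x)).
have H := is_derive_add (is_derive_add
   (is_derive_mul (smooth_is_derive k su Wx) (DY k Wx)) (is_derive_opp Hb))
   (is_derive_opp (is_derive_mul (is_derive_mul Dc (is_derive_cstf k 2^-1 x)) Hq)).
refine (is_derive_eq H _).
rewrite -/(lift_d k x) !mul0r mulr0 addr0 mul0r add0r.
have -> : \sum_j (0 * x 0 j + lift_b j x * (k == j)%:R) = lift_b k x.
  rewrite sum3; move: k {H Hb Hq Dc}; apply: ord3P; rewrite /=; ring.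
have -> : \sum_j ((k == j)%:R * x 0 j + x 0 j * (k == j)%:R) = 2 * x 0 k.
  rewrite sum3; move: k {H Hb Hq Dc}; apply: ord3P; rewrite /=; ring.
rewrite {1}/lift_b mulrA mulfVK ?pnatr_eq0//; ring.
Qed.

End Lift.

(** The form is invariant under translations, so that it can be evaluated on the value
    and the derivatives at x. *)
Lemma lift_pairing {R : realType} (f u : 'rV[R]_3 -> R) (Y Y1 Z Z1 : R -> R) x :
  u x ^+ 2 * invJ f x = 1 ->
  pairing (lift_coef f u Y Y1 x) (lift_coef f u Z Z1 x)
  = gkappa f u x * Y (f x) * Z (f x) + Y1 (f x) * Z1 (f x).
Proof.
move=> uJ.
have -> : Y1 (f x) * Z1 (f x) = u x ^+ 2 * invJ f x * (Y1 (f x) * Z1 (f x)).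
  by rewrite uJ mul1r.
rewrite /pairing /lift_coef /= /lift_a /lift_b /gkappa /lift_d /lift_c /gdot /invJ !sum3.
move: (pd i0 f x) (pd i1 f x) (pd i2 f x) (pd i0 u x) (pd i1 u x) (pd i2 u x) => f0 f1 f2 u0 u1 u2.
move: (gtau f u x) (u x) (Y (f x)) (Y1 (f x)) (Z (f x)) (Z1 (f x)) => t v y y1 z z1.
by field.
Qed.

(** * Absence of critical points *)

Lemma clopen_full {T : topologicalType} (U A : set T) : connected U -> A `<=` U ->
  A !=set0 -> (forall x, A x -> nbhs x A) -> (forall x, U x -> closure A x -> A x) ->
  A = U.
Proof.
move=> cU AU A0 oA clA; apply: cU => //.
- exists A; first by rewrite openE.
  by rewrite setIC; apply/esym/setIidl.
- exists (closure A); first exact: closed_closure.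
  apply/seteqP; split=> x; first by move=> Ax; split; [exact: AU|exact: subset_closure].
  by case; exact: clA.
Qed.

Lemma closure_eq {T : topologicalType} {R : realType} (A : set T) (g : T -> R) x c :
  {for x, continuous g} -> closure A x -> (forall y, A y -> g y = c) -> g x = c.
Proof.
move=> cg clA Ag; apply/eqP; rewrite -subr_eq0 -normr_le0; apply/ler_addgt0Pl => e e0.
rewrite addr0.
have H : nbhs x [set y | `|g x - g y| < e] by exact: (@cvgr_dist_lt _ _ _ _ _ g _ cg).
have [y [Ay]] := clA _ H; rewrite /= (Ag y Ay) => h; exact: ltW.
Qed.

(** The set where g takes a given value is both open and closed in U. *)
Lemma connected_const {R : realType} (U : set 'rV[R]_3) (g : 'rV[R]_3 -> R) :
  open U -> connected U -> (forall x, U x -> forall i, is_derive x (ev i) g 0) ->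
  forall x y, U x -> U y -> g y = g x.
Proof.
move=> oU cU dg x y Ux Uy.
have loc z : U z -> exists2 e : R, 0 < e & forall w, ball z e w -> U w /\ g w = g z.
  move=> Uz; have /nbhs_ballP[e e0 he] : nbhs z U by exact: open_nbhs_nbhs.
  exists e => // w zw; split; first exact: he.
  by apply: grad0_ball zw => // v zv i; exact: dg (he _ zv) i.
suff : [set z | U z /\ g z = g x] = U.
  by move=> E; have [] : [set z | U z /\ g z = g x] y by rewrite E.
apply: clopen_full => //.
- by move=> z [].
- by exists x.
- move=> z [Uz gz]; have [e e0 he] := loc z Uz.
  by apply/nbhs_ballP; exists e => // w /he[Uw gw]; split => //; rewrite gw.
- move=> z Uz clz; split=> //; have [e e0 he] := loc z Uz.
  have [w [[_ gw] zw]] := clz _ (nbhsx_ballx z e e0).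
  by have [_ <-] := he w zw.
Qed.

Lemma invJ_ge0 {R : realType} (f : 'rV[R]_3 -> R) x : 0 <= invJ f x.
Proof. by apply: sumr_ge0 => i _; rewrite -expr2 sqr_ge0. Qed.

(** The factor u for which df has length one in the metric u^(-2) |dx|^2. *)
Definition confactor {R : realType} (f : 'rV[R]_3 -> R) (x : 'rV[R]_3) : R :=
  Num.sqrt (invJ f x)^-1.

Lemma smooth_quadric {R : realType} (U : set 'rV[R]_3) p : open U -> smooth_on U (quadric p).
Proof.
move=> oU; apply: smooth_add => //.
  apply: smooth_add => //; first exact: smooth_cst.
  by apply: smooth_sum => // i; apply: smooth_mul => //; [exact: smooth_cst|exact: smooth_coord].
apply: smooth_mul => //; first exact: smooth_cst.
by apply: smooth_sum => // i; apply: smooth_mul => //; exact: smooth_coord.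
Qed.

Lemma is_derive_mull {R : realType} (k : R) (g : R -> R) (t dg : R) :
  is_derive t (1 : R) g dg -> is_derive t (1 : R) (fun t => k * g t) (k * dg).
Proof.
move=> H; refine (is_derive_eq (is_deriveM (is_derive_cst k t (1 : R)) H) _).
by rewrite scaler0 addr0.
Qed.

Lemma ode_cos {R : realType} (k : R) :
  ode (k ^+ 2) (fun t => cos (k * t)) (fun t => - k * sin (k * t)).
Proof.
split=> t; have Dk := is_derive_mull k (is_derive_id t (1 : R)).
  refine (is_derive_eq (is_derive_comp1 Dk (is_derive_cos _)) _).
  by rewrite mulr1 mulrC mulrN mulNr.
refine (is_derive_eq (is_derive_mull (- k) (is_derive_comp1 Dk (is_derive_sin _))) _).
by rewrite /=; ring.
Qed.

Lemma ode_sin {R : realType} (k : R) :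
  ode (k ^+ 2) (fun t => sin (k * t)) (fun t => k * cos (k * t)).
Proof.
split=> t; have Dk := is_derive_mull k (is_derive_id t (1 : R)).
  refine (is_derive_eq (is_derive_comp1 Dk (is_derive_sin _)) _).
  by rewrite mulr1 mulrC.
refine (is_derive_eq (is_derive_mull k (is_derive_comp1 Dk (is_derive_cos _))) _).
by rewrite /=; ring.
Qed.

Lemma ode_exp {R : realType} (k : R) :
  ode (- k ^+ 2) (fun t => expR (k * t)) (fun t => k * expR (k * t)).
Proof.
have D t : is_derive t (1 : R) (fun t => expR (k * t)) (k * expR (k * t)).
  have Dk := is_derive_mull k (is_derive_id t (1 : R)).
  refine (is_derive_eq (is_derive_comp1 Dk (is_derive_expR _)) _).
  by rewrite mulr1 mulrC.
split=> // t; refine (is_derive_eq (is_derive_mull k (D t)) _).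
by rewrite opprK expr2 mulrA.
Qed.

Lemma ode_cst {R : realType} : ode 0 (fun=> 1) (fun=> 0 : R).
Proof.
split=> t; first exact: is_derive_cst.
by refine (is_derive_eq (is_derive_cst (0 : R) t (1 : R)) _); rewrite oppr0 mul0r.
Qed.

Lemma ode_id {R : realType} : ode 0 id (fun=> 1 : R).
Proof.
split=> t; first exact: is_derive_id.
by refine (is_derive_eq (is_derive_cst (1 : R) t (1 : R)) _); rewrite oppr0 mul0r.
Qed.

Section Global.
Variables (R : realType) (U : set 'rV[R]_3) (f : 'rV[R]_3 -> R).
Hypotheses (openU : open U) (connectedU : connected U) (smoothf : smooth_on U f).
Hypothesis nonconstant : ~ exists k : R, forall x, U x -> f x = k.
Hypotheses (X0 : forall x, U x -> invX f x = 0) (Y0 : forall x, U x -> invY f x = 0).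

Local Notation u := (confactor f).
Let W := U `&` [set x | invJ f x != 0].

Lemma smooth_invJ : smooth_on U (invJ f).
Proof.
by apply: smooth_sum => // i; apply: smooth_mul => //; exact: smooth_pd.
Qed.

Lemma open_noncritical : open W.
Proof.
by apply: open_neq0 => // x Ux; exact: smooth_continuous smooth_invJ Ux.
Qed.

Let WU : W `<=` U. Proof. by move=> x []. Qed.
Let oW := open_noncritical.
Let sf : smooth_on W f. Proof. exact: smooth_sub smoothf. Qed.

Lemma confactor_gt0 x : W x -> 0 < u x.
Proof. by move=> [_ J0]; rewrite sqrtr_gt0 invr_gt0 lt0r J0 invJ_ge0. Qed.

Lemma confactorJ x : W x -> u x ^+ 2 * invJ f x = 1.
Proof.
move=> Wx; have [_ J0] := Wx.
by rewrite sqr_sqrtr ?invr_ge0 ?invJ_ge0// mulVf.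
Qed.

Lemma smooth_confactor : smooth_on W u.
Proof.
have sJ : smooth_on W (invJ f) by exact: smooth_sub smooth_invJ.
have sI : smooth_on W (fun x => (invJ f x)^-1) by apply: smooth_inv => // x [].
apply: (@smooth_bootstrap _ _ _ (fun i x =>
  u x * (invJ f x * 2^-1 * pd i (fun x => (invJ f x)^-1) x))) => //.
- move=> x Wx; have cI := smooth_continuous sI Wx.
  exact: (continuous_comp cI (@sqrt_continuous _ _)).
- move=> i x Wx.
  have I0 : 0 < (invJ f x)^-1 by have := confactor_gt0 Wx; rewrite sqrtr_gt0.
  have H := is_derive_comp1 (smooth_is_derive i sI Wx) (is_derive1_sqrt I0).
  refine (is_derive_eq H _); rewrite -/(u x) mulrA; congr (_ * _).
  have v0 := lt0r_neq0 (confactor_gt0 Wx); have := confactorJ Wx.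
  move: (u x) (invJ f x) v0 => v J v0 e.
  have -> : v * (J * 2^-1) = (v ^+ 2 * J) / (2 * v) by field.
  by rewrite e mul1r.
- move=> i k Ck; apply: Ck_on_mul => //; apply: smooth_mul => //.
    by apply: smooth_mul => //; exact: smooth_cst.
  exact: smooth_pd.
Qed.

Let su := smooth_confactor.
Let uJ := confactorJ.
Let XW x : W x -> invX f x = 0. Proof. by move=> /WU; exact: X0. Qed.
Let YW x : W x -> invY f x = 0. Proof. by move=> /WU; exact: Y0. Qed.

(** On a ball without critical points kappa is constant; only then do the lifts for
    that value of kappa have constant coefficients. *)
Lemma local_rigidity x : W x -> exists2 e : R, 0 < e & forall y, ball x e y ->
  [/\ W y, gkappa f u y = gkappa f u x & forall Y Y1, ode (gkappa f u x) Y Y1 ->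
     lift_coef f u Y Y1 y = lift_coef f u Y Y1 x].
Proof.
move=> Wx; have /nbhs_ballP[e e0 he] : nbhs x W by exact: open_nbhs_nbhs.
exists e; [exact: e0|move=> y xy].
have gcst (g : 'rV[R]_3 -> R) :
    (forall z, ball x e z -> forall i, is_derive z (ev i) g 0) -> g y = g x.
  by move=> dg; exact: (grad0_ball e0 dg xy).
have kc z : ball x e z -> gkappa f u z = gkappa f u x.
  move=> xz; apply: (grad0_ball e0 _ xz) => w xw i; have Ww := he w xw.
  have := smooth_is_derive i (smooth_gkappa oW sf su) Ww.
  by rewrite (pd_gkappa oW sf su uJ XW YW).
split; [exact: he|exact: kc|move=> Y Y1 oY].
rewrite /lift_coef; congr (_, _, _).
- apply: gcst => z xz i.
  exact: (is_derive_lift_a oW sf su uJ XW YW oY i (he _ xz) (kc _ xz)).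
- apply/funext => j; apply: gcst => z xz i.
  exact: (is_derive_lift_b oW sf su uJ XW YW oY i j (he _ xz) (kc _ xz)).
- apply: gcst => z xz i.
  exact: (is_derive_lift_c oW sf su uJ XW YW oY i (he _ xz) (kc _ xz)).
Qed.

Lemma exists_noncritical : exists q, W q.
Proof.
apply: contrapT => noW.
have dJ0 x : U x -> invJ f x = 0.
  by move=> Ux; apply/eqP; apply: contrapT => /negP J0; apply: noW; exists x.
have [U0|/set0P[x Ux]] := eqVneq U set0.
  by apply: nonconstant; exists 0 => x; rewrite U0.
apply: nonconstant; exists (f x) => y Uy; apply: connected_const Uy => // z Uz i.
have p0 := sum_sq_eq0 (dJ0 z Uz) i.
by have := smooth_is_derive i smoothf Uz; rewrite p0.
Qed.

(** The set A is where the gradient does not vanish and kappa and all the coefficients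
    agree with those at q. It is open by [local_rigidity]. On A the product of J with
    a polynomial is 1, which stays true on the closure of A and excludes a zero of J
    there. *)
Lemma noncritical_of_first_integral q Y Y1 Z Z1 a b c : W q ->
  ode (gkappa f u q) Y Y1 -> ode (gkappa f u q) Z Z1 ->
  (forall t, a * (Y t * Y t) + b * (Y t * Z t) + c * (Z t * Z t) = 1) ->
  forall x, U x -> W x /\ gkappa f u x = gkappa f u q.
Proof.
move=> Wq oY oZ first_int.
pose A := [set x | [/\ W x, gkappa f u x = gkappa f u q,
  lift_coef f u Y Y1 x = lift_coef f u Y Y1 q & lift_coef f u Z Z1 x = lift_coef f u Z Z1 q]].
suff E : A = U by move=> x; rewrite -E => -[].
apply: clopen_full; first exact: connectedU.
- by move=> x [] /WU.
- by exists q; split.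
- move=> x [Wx kx cY cZ]; have [e e0 he] := local_rigidity Wx.
  apply/nbhs_ballP; exists e; [exact: e0|move=> y /he[Wy ky]].
  rewrite kx => co; split; first exact: Wy.
  + by rewrite ky.
  + exact: etrans (co _ _ oY) cY.
  + exact: etrans (co _ _ oZ) cZ.
- move=> x Ux clx.
  pose P := quadric (lift_coef f u Y Y1 q); pose Q := quadric (lift_coef f u Z Z1 q).
  have sP : smooth_on U P by exact: smooth_quadric.
  have sQ : smooth_on U Q by exact: smooth_quadric.
  have JM : invJ f x * (a * (P x * P x) + b * (P x * Q x) + c * (Q x * Q x)) = 1.
    apply: (@closure_eq _ _ A (fun x =>
      invJ f x * (a * (P x * P x) + b * (P x * Q x) + c * (Q x * Q x)))) => //.
      apply: smooth_continuous Ux; apply: smooth_mul => //; first exact: smooth_invJ.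
      by do 2?apply: smooth_add => //; apply: smooth_mul => //;
         do ?[exact: smooth_cst|exact: smooth_mul].
    move=> y [Wy _ cY cZ].
    rewrite /P /Q -cY -cZ -!lift_coefE -[RHS](uJ Wy) -[u y ^+ 2]mulr1 -(first_int (f y)).
    move: (u y) (Y (f y)) (Z (f y)) (invJ f y) => v yy zz J; ring.
  have Wx : W x.
    by split => //=; apply/eqP => J0; move: JM; rewrite J0 mul0r => /eqP; rewrite eq_sym oner_eq0.
  have [e e0 he] := local_rigidity Wx.
  have [y [[Wy ky cY cZ] xy]] := clx _ (nbhsx_ballx x e e0).
  have [_ kyx co] := he y xy.
  have kx : gkappa f u x = gkappa f u q by rewrite -kyx.
  rewrite kx in co; split; [exact: Wx|exact: kx| |].
  + exact: etrans (esym (co _ _ oY)) cY.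
  + exact: etrans (esym (co _ _ oZ)) cZ.
Qed.

Lemma lift_coef_cst k0 q : (forall x, U x -> W x /\ gkappa f u x = k0) -> U q ->
  forall Y Y1, ode k0 Y Y1 -> forall x, U x -> lift_coef f u Y Y1 x = lift_coef f u Y Y1 q.
Proof.
move=> Uk Uq Y Y1 oY x Ux; rewrite /lift_coef.
have gcst (g : 'rV[R]_3 -> R) :
    (forall z, W z -> gkappa f u z = k0 -> forall i, is_derive z (ev i) g 0) -> g x = g q.
  move=> dg; apply: (connected_const openU connectedU _ Uq Ux) => z /Uk[Wz kz].
  exact: dg.
congr (_, _, _).
- apply: gcst => z Wz kz i; exact: (is_derive_lift_a oW sf su uJ XW YW oY i Wz kz).
- apply/funext => j; apply: gcst => z Wz kz i.
  exact: (is_derive_lift_b oW sf su uJ XW YW oY i j Wz kz).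
- apply: gcst => z Wz kz i; exact: (is_derive_lift_c oW sf su uJ XW YW oY i Wz kz).
Qed.

Lemma conformal_lift : exists (k0 : R) (v : 'rV[R]_3 -> R)
    (L : (R -> R) -> (R -> R) -> R * ('I_3 -> R) * R),
  [/\ forall x, U x -> 0 < v x,
    forall Y Y1, ode k0 Y Y1 -> forall x, U x -> v x * Y (f x) = quadric (L Y Y1) x &
    forall Y Y1 Z Z1, ode k0 Y Y1 -> ode k0 Z Z1 -> forall x, U x ->
      pairing (L Y Y1) (L Z Z1) = k0 * Y (f x) * Z (f x) + Y1 (f x) * Z1 (f x)].
Proof.
have [q Wq] := exists_noncritical; have Uq := WU Wq.
pose k0 := gkappa f u q.
have Uk : forall x, U x -> W x /\ gkappa f u x = k0.
  have [k00|k00|k00] := ltrgt0P k0.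
  - pose k := Num.sqrt k0; have kk : k0 = k ^+ 2 by rewrite sqr_sqrtr// ltW.
    have oc := ode_cos k; have os := ode_sin k; rewrite -kk in oc os.
    apply: (@noncritical_of_first_integral q _ _ _ _ 1 0 1 Wq oc os) => t.
    by rewrite !mul1r mul0r addr0 -!expr2 cos2Dsin2.
  - pose k := Num.sqrt (- k0).
    have kk : k0 = - k ^+ 2 by rewrite sqr_sqrtr ?opprK// oppr_ge0 ltW.
    have o1 := ode_exp k; have o2 := ode_exp (- k).
    rewrite sqrrN -kk in o2; rewrite -kk in o1.
    apply: (@noncritical_of_first_integral q _ _ _ _ 0 1 0 Wq o1 o2) => t.
    by rewrite !mul0r mul1r add0r addr0 mulNr -expRD subrr expR0.
  - have o1 : ode k0 (fun=> 1) (fun=> 0) by rewrite k00; exact: ode_cst.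
    apply: (@noncritical_of_first_integral q _ _ _ _ 1 0 0 Wq o1 o1) => t.
    by rewrite !mul0r !mul1r !addr0.
exists k0, u, (fun Y Y1 => lift_coef f u Y Y1 q); split.
- by move=> x /Uk[/confactor_gt0].
- by move=> Y Y1 oY x Ux; rewrite -(lift_coef_cst Uk Uq oY Ux) -lift_coefE.
- move=> Y Y1 Z Z1 oY oZ x Ux; have [Wx kx] := Uk x Ux.
  rewrite -(lift_coef_cst Uk Uq oY Ux) -(lift_coef_cst Uk Uq oZ Ux).
  by rewrite -kx; exact: lift_pairing (uJ Wx).
Qed.

End Global.

(** * Quadrics, inversions and reflections *)

Lemma dot_ge0 {R : realType} (x : 'rV[R]_3) : 0 <= dot x x.
Proof. by apply: sumr_ge0 => i _; rewrite -expr2 sqr_ge0. Qed.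

Lemma dot_eq0 {R : realType} (x : 'rV[R]_3) : (dot x x == 0) = (x == 0).
Proof.
apply/eqP/eqP => [/sum_sq_eq0 h|->]; first by apply/rowP => i; rewrite h mxE.
by rewrite /dot big1// => i _; rewrite mxE mul0r.
Qed.

Lemma dot_gt0 {R : realType} (x : 'rV[R]_3) : x != 0 -> 0 < dot x x.
Proof. by move=> x0; rewrite lt0r dot_eq0 x0 dot_ge0. Qed.

Definition inversion {R : realType} (q x : 'rV[R]_3) : 'rV[R]_3 :=
  q + (dot (x - q) (x - q))^-1 *: (x - q).

(** The coefficients of y -> |y - q|^2 P(x), where x is the image of y by the inversion
    of centre q. *)
Definition inv_quad {R : realType} (q : 'rV[R]_3) (p : quad R) : quad R :=
  let al := quadric p q in
  let B i := p.1.2 i + p.2 * q 0 i in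
  (p.2 / 2 - \sum_i B i * q 0 i + al * \sum_i q 0 i ^+ 2,
   fun i => B i - 2 * al * q 0 i, 2 * al).

Lemma quadric_inversion {R : realType} (q x : 'rV[R]_3) (p : quad R) : x != q ->
  quadric p x = dot (x - q) (x - q) * quadric (inv_quad q p) (inversion q x).
Proof.
move=> xq; have : dot (x - q) (x - q) != 0 by rewrite dot_eq0 subr_eq0.
have -> : x = q + (x - q) by rewrite addrC subrK.
move: (x - q) => d; rewrite /inversion addrAC subrr add0r.
rewrite /quadric /inv_quad /dot !sum3 !mxE /=.
rewrite /quadric !sum3.
case: p => [[a b] c] /=.
move: (q 0 i0) (q 0 i1) (q 0 i2) (d 0 i0) (d 0 i1) (d 0 i2) (b i0) (b i1) (b i2).
move=> q0 q1 q2 d0 d1 d2 b0 b1 b2 N0; by field.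
Qed.

Lemma pairing_inv_quad {R : realType} (q : 'rV[R]_3) (p p' : quad R) :
  pairing (inv_quad q p) (inv_quad q p') = pairing p p'.
Proof.
rewrite /pairing /inv_quad /= /quadric !sum3.
case: p => [[a b] c]; case: p' => [[a' b'] c'] /=.
move: (q 0 i0) (q 0 i1) (q 0 i2) (b i0) (b i1) (b i2) (b' i0) (b' i1) (b' i2).
move=> q0 q1 q2 b0 b1 b2 b0' b1' b2'; by field.
Qed.

(** A conformal transformation with its pointwise form psi on U and its action T on
    quadrics, which are transported up to a positive factor depending on the point. *)
Definition chart {R : realType} (U : set 'rV[R]_3) Psi (psi : 'rV[R]_3 -> 'rV[R]_3)
    (T : quad R -> quad R) :=
  [/\ mobius Psi,
      forall x, U x -> Psi (Some x) = Some (psi x) /\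
        exists2 rho : R, 0 < rho & forall p, quadric p x = rho * quadric (T p) (psi x) &
      forall p p', pairing (T p) (T p') = pairing p p'].

Lemma chart_id {R : realType} (U : set 'rV[R]_3) : chart U id id id.
Proof.
split=> //; first exact: mobius_id.
by move=> x _; split=> //; exists 1 => // p; rewrite mul1r.
Qed.

Lemma chart_inversion {R : realType} (U : set 'rV[R]_3) q : (forall x, U x -> x != q) ->
  chart U (sphere_refl q 1 \o id) (inversion q) (inv_quad q).
Proof.
move=> Uq; split; last exact: pairing_inv_quad.
- by apply: mobius_sphere => //; exact: mobius_id.
- move=> x /Uq xq; split; first by rewrite /= (negbTE xq) expr1n div1r.
  exists (dot (x - q) (x - q)); first by rewrite dot_gt0// subr_eq0.
  by move=> p; exact: quadric_inversion.
Qed.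

Definition center {R : realType} (p : quad R) : 'rV[R]_3 := \row_i (- p.1.2 i / p.2).

Lemma complete_square {R : realType} (p : quad R) x : p.2 != 0 ->
  quadric p x = p.2 / 2 * dot (x - center p) (x - center p) - pairing p p / (2 * p.2).
Proof.
case: p => [[a b] c] /= c0.
rewrite /pairing /quadric /dot !sum3 !mxE /=; by field.
Qed.

Lemma null_quadric {R : realType} (p : quad R) : pairing p p = 0 -> p.2 != 0 ->
  forall x, quadric p x = p.2 / 2 * dot (x - center p) (x - center p).
Proof. by move=> pp p0 x; rewrite complete_square// pp mul0r subr0. Qed.

(** A quadric of square zero is a constant, or a multiple of the squared distance to a
    point; in the second case the inversion at that point makes it constant. *)
Lemma null_chart {R : realType} (U : set 'rV[R]_3) (Q : quad R) :
  pairing Q Q = 0 -> (forall x, U x -> quadric Q x != 0) ->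
  exists Psi psi T, chart U Psi psi T /\ (T Q).2 = 0.
Proof.
move=> QQ QU; have [c0|c0] := eqVneq Q.2 0.
  by exists id, id, id; split=> //; exact: chart_id.
pose q := center Q.
have Qq : quadric Q q = 0.
  by rewrite null_quadric// subrr (_ : dot 0 0 = 0) ?mulr0//; apply/eqP; rewrite dot_eq0.
exists (sphere_refl q 1 \o id), (inversion q), (inv_quad q); split.
  by apply: chart_inversion => x /QU; apply: contraNneq => ->; apply/eqP.
by rewrite /= Qq mulr0.
Qed.

Definition refl {R : realType} (w : 'rV[R]_3) (t : R) (y : 'rV[R]_3) :=
  y - (2 * (dot y w - t) / dot w w) *: w.

Lemma dot_refl_axis {R : realType} (b : 'I_3 -> R) (s : R) (j : 'I_3)
    (w : 'rV[R]_3 := \row_i (s * b i - (i == j)%:R)) :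
  \sum_i b i * b i = 1 -> s * s = 1 -> dot w w = 2 * (1 - s * b j).
Proof.
move=> bb ss.
have -> : 2 * (1 - s * b j) = s * s * (\sum_i b i * b i) + 1 - 2 * (s * b j).
  by rewrite ss bb; ring.
rewrite /dot !sum3 !mxE; move: j {w}; apply: ord3P => /=; ring.
Qed.

(** The reflection exchanging the hyperplanes y_j = 0 and d + b . y = 0. The sign s is
    chosen such that s b is not the j-th basis vector, since w would vanish if it were. *)
Lemma refl_coord {R : realType} (b : 'I_3 -> R) (d : R) (j : 'I_3) :
  \sum_i b i * b i = 1 ->
  exists (s : R) (w : 'rV[R]_3), [/\ s * s = 1, w = \row_i (s * b i - (i == j)%:R), w != 0 &
    forall y, refl w (- s * d) y 0 j = s * (d + \sum_i b i * y 0 i)].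
Proof.
move=> b1.
have [s ss sb] : exists2 s : R, s * s = 1 & s * b j != 1.
  have [bj|bj] := eqVneq (b j) 1.
    by exists (-1); rewrite ?mulrNN ?mul1r// bj mulN1r; apply/eqP; lra.
  by exists 1; rewrite ?mul1r.
pose w : 'rV[R]_3 := \row_i (s * b i - (i == j)%:R).
have wj : w 0 j = s * b j - 1 by rewrite mxE eqxx.
have w0 : w != 0.
  apply: contraNneq sb => w0; move: wj; rewrite w0 mxE => /eqP.
  by rewrite eq_sym subr_eq0.
exists s, w; split=> // y.
have dw : dot w w = 2 * (1 - s * b j) by exact: dot_refl_axis.
have dy : dot y w = s * (\sum_i b i * y 0 i) - y 0 j.
  rewrite /dot !sum3 !mxE; move: j {sb wj w0 w dw}; apply: ord3P => /=; ring.
have dw0 : 1 - s * b j != 0 by rewrite subr_eq0 eq_sym.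
rewrite /refl !mxE dw dy eqxx -[true%:R]/(1); move: (\sum__ _) (b j) dw0 => a bj dw0.
by field.
Qed.

(** A reflection carries affine functions to affine functions and, by
    [refl_linear_norm], keeps the length of their gradients, so that [refl_coord]
    applies a second time. *)
Lemma refl_affine {R : realType} (w : 'rV[R]_3) (t : R) (b : 'I_3 -> R) (y : 'rV[R]_3) : w != 0 ->
  let B := 2 * (\sum_i b i * w 0 i) / dot w w in
  \sum_i b i * y 0 i = B * t + \sum_i (b i - B * w 0 i) * refl w t y 0 i.
Proof.
rewrite -dot_eq0 /= /refl /dot !sum3 !mxE => w0; move: w0.
move: (w 0 i0) (w 0 i1) (w 0 i2) (y 0 i0) (y 0 i1) (y 0 i2) (b i0) (b i1) (b i2).
move=> w0 w1 w2 y0 y1 y2 b0 b1 b2 n0; by field.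
Qed.

Lemma refl_linear_norm {R : realType} (w : 'rV[R]_3) (b : 'I_3 -> R) : w != 0 ->
  let B := 2 * (\sum_i b i * w 0 i) / dot w w in
  \sum_i (b i - B * w 0 i) * (b i - B * w 0 i) = \sum_i b i * b i.
Proof.
rewrite -dot_eq0 /= /dot !sum3 => w0; move: w0.
move: (w 0 i0) (w 0 i1) (w 0 i2) (b i0) (b i1) (b i2).
move=> w0 w1 w2 b0 b1 b2 n0; by field.
Qed.

(** The second reflection has its axis orthogonal to the j-th basis vector, hence
    preserves the coordinate prepared by the first one. *)
Lemma refl_pair {R : realType} (b b' : 'I_3 -> R) (d d' : R) (j j' : 'I_3) : j != j' ->
  \sum_i b i * b i = 1 -> \sum_i b' i * b' i = 1 -> \sum_i b i * b' i = 0 ->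
  exists (s s' t t' : R) (w w' : 'rV[R]_3),
   [/\ s * s = 1, s' * s' = 1, w != 0, w' != 0 & forall y,
     refl w' t' (refl w t y) 0 j = s * (d + \sum_i b i * y 0 i) /\
     refl w' t' (refl w t y) 0 j' = s' * (d' + \sum_i b' i * y 0 i)].
Proof.
move=> jj bb bb' b0.
have [s [w [ss wE w0 hw]]] := refl_coord d j bb.
pose B := 2 * (\sum_i b' i * w 0 i) / dot w w.
pose c i := b' i - B * w 0 i.
have cc : \sum_i c i * c i = 1 by rewrite refl_linear_norm.
have cj : c j = 0.
  have dw : dot w w = 2 * (1 - s * b j) by rewrite wE; exact: dot_refl_axis.
  have sb : 1 - s * b j != 0.
    by apply: contraNneq w0 => sb; rewrite -dot_eq0 dw sb mulr0.
  have bw : \sum_i b' i * w 0 i = - b' j.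
    have -> : - b' j = s * (\sum_i b i * b' i) - b' j by rewrite b0; ring.
    rewrite wE !sum3 !mxE; move: j {jj wE hw B c cc sb dw}; apply: ord3P => /=; ring.
  rewrite /c /B bw dw wE mxE eqxx -[true%:R]/(1); move: (b j) (b' j) sb => x y sb.
  by field.
have [s' [w' [ss' wE' w0' hw']]] := refl_coord (d' + B * (- s * d)) j' cc.
exists s, s', (- s * d), (- s' * (d' + B * (- s * d))), w, w'; split=> // y; split.
  have w'j : w' 0 j = 0 by rewrite wE' mxE cj (negbTE jj) mulr0 subrr.
  by rewrite {1}/refl !mxE w'j mulr0 subr0 -hw /refl !mxE.
by rewrite hw' (refl_affine (- s * d) b' y w0) addrA.
Qed.

(** * The parabolic and hyperbolic pencils *)

(** The conclusion of the theorem at the point p. *)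
Definition local_model {R : realType} (U : set 'rV[R]_3) (f : 'rV[R]_3 -> R) p :=
  exists W : set 'rV[R]_3,
    [/\ open W, W p, W `<=` U &
      exists (c : R)
             (Phi : one_point_compactification 'rV[R]_3 ->
                    one_point_compactification 'rV[R]_3)
             (V : set 'rV[R]_3) (h : 'rV[R]_3 -> R),
        [/\ c != 0, mobius Phi,
            Phi @` (Some @` W) = Some @` V,
            model_on V h /\ smooth_on V h &
            forall x y, W x -> Phi (Some x) = Some y -> f x = c * h y]].

Lemma local_modelP {R : realType} (U N D : set 'rV[R]_3) (f : 'rV[R]_3 -> R) p c Phi phi h :
  open N -> N p -> N `<=` U -> c != 0 -> mobius Phi ->
  (forall x, N x -> [/\ Phi (Some x) = Some (phi x), D (phi x) & f x = c * h (phi x)]) ->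
  model_on (phi @` N) h -> smooth_on D h -> local_model U f p.
Proof.
move=> oN Np NU c0 mP hN mo sm; exists N; split=> //.
exists c, Phi, (phi @` N), h; split=> //.
- apply/seteqP; split.
    move=> _ [_ [x Nx <-] <-]; have [-> _ _] := hN x Nx.
    by exists (phi x) => //; exists x.
  move=> _ [_ [x Nx <-] <-]; have [<- _ _] := hN x Nx.
  by exists (Some x) => //; exists x.
- split=> //; apply: smooth_sub sm => _ [x Nx <-].
  by have [] := hN x Nx.
- by move=> x y Nx; have [-> _ ->] := hN x Nx => -[<-].
Qed.

Lemma local_model_linear {R : realType} (U : set 'rV[R]_3) (f v : 'rV[R]_3 -> R) (P Q : quad R) p :
  open U -> U p -> (forall x, U x -> 0 < v x) ->
  (forall x, U x -> v x = quadric Q x) -> (forall x, U x -> v x * f x = quadric P x) ->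
  pairing Q Q = 0 -> pairing P P = 1 -> pairing P Q = 0 -> local_model U f p.
Proof.
move=> oU Up v0 vQ vP QQ PP PQ.
have [|Psi [psi [T [[mP hPsi pT] TQ]]]] := @null_chart _ U Q QQ.
  by move=> x Ux; rewrite -vQ// lt0r_neq0// v0.
move: (pT Q Q) (pT P P) (pT P Q); rewrite QQ PP PQ.
case EQ : (T Q) TQ => [[a b] c] /= cE; subst c; case EP : (T P) => [[a' b'] c'].
rewrite /pairing /= !mulr0 !subr0 => /sum_sq_eq0 b0 PP' PQ'.
have TQE y : quadric (T Q) y = a.
  by rewrite EQ /quadric /= mul0r mul0r addr0 big1 ?addr0// => i _; rewrite b0 mul0r.
have a0 : 0 < a.
  have [_ [rho rho0 hq]] := hPsi p Up; have := v0 p Up.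
  by rewrite vQ// hq TQE pmulr_rgt0.
have c0 : c' = 0.
  move: PQ'; rewrite big1 ?sub0r; last by move=> i _; rewrite b0 mulr0.
  by move=> /eqP; rewrite oppr_eq0 mulf_eq0 (gt_eqF a0) /= => /eqP.
rewrite c0 mulr0 !subr0 in PP'.
have [s [w [ss _ w0 hw]]] := refl_coord a' i0 PP'.
have s0 : s != 0 by apply/eqP => s0; move: ss; rewrite s0 mul0r => /eqP; rewrite eq_sym oner_eq0.
apply: (@local_modelP _ U U setT f p (s / a) (plane_refl w (- s * a') \o Psi)
  (refl w (- s * a') \o psi) (@crd1 R)) => //.
- by rewrite mulf_neq0// invr_eq0 gt_eqF.
- exact: mobius_plane.
- move=> x Ux; have [PsiE [rho rho0 hq]] := hPsi x Ux; split=> //.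
    by rewrite /= PsiE.
  have vx := v0 x Ux; apply: (mulfI (lt0r_neq0 vx)).
  rewrite vP// vQ// !hq TQE EP c0 /crd1 /= hw /quadric /= !mul0r addr0.
  move: (\sum__ _) => z.
  have -> : rho * a * (s / a * (s * (a' + z))) = s * s * (rho * (a' + z)) * (a / a) by ring.
  by rewrite ss mul1r divff ?gt_eqF// mulr1.
- by apply: Or41 => y _.
- exact: smooth_coord.
Qed.

Definition normsq {R : realType} (y : 'rV[R]_3) : R :=
  crd1 y ^+ 2 + crd2 y ^+ 2 + crd3 y ^+ 2.

Lemma normsqE {R : realType} (y : 'rV[R]_3) : normsq y = dot y y.
Proof. by rewrite /normsq /dot sum3 -!expr2. Qed.

Lemma smooth_normsq {R : realType} (U : set 'rV[R]_3) : open U -> smooth_on U normsq.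
Proof.
move=> oU; by do 2?apply: smooth_add => //; apply: smooth_mul => //; exact: smooth_coord.
Qed.

Lemma smooth_ln_normsq {R : realType} :
  smooth_on (setT `&` [set y : 'rV[R]_3 | normsq y != 0]) (fun y => ln (normsq y)).
Proof.
set D := _ `&` _.
have oD : open D.
  apply: open_neq0; first exact: openT.
  by move=> x _; exact: (smooth_continuous (smooth_normsq openT)).
have sD : smooth_on D normsq by exact: smooth_normsq.
have D0 x : D x -> 0 < normsq x.
  by move=> [_ n0]; rewrite lt0r; apply/andP; split; [exact: n0|rewrite normsqE dot_ge0].
apply: (@smooth_comp _ _ _ _ (fun y => (normsq y)^-1)) => //.
- by apply: smooth_inv => // x [].
- by move=> x /D0 n0; exact: continuous_ln.
- by move=> x /D0 n0; exact: is_derive1_ln.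
Qed.

(** The reflection in the bisector of 0 and m, or the identity if m = 0. *)
Lemma exists_refl_to_0 {R : realType} (m : 'rV[R]_3) :
  exists Phi (phi : 'rV[R]_3 -> 'rV[R]_3),
  [/\ forall Psi, mobius Psi -> mobius (Phi \o Psi),
      forall y, Phi (Some y) = Some (phi y) &
      forall y, normsq (phi y) = dot (y - m) (y - m)].
Proof.
have [->|m0] := eqVneq m 0.
  by exists id, id; split=> // y; rewrite subr0 normsqE.
exists (plane_refl m (dot m m / 2)), (refl m (dot m m / 2)); split=> //.
  by move=> Psi mP; exact: mobius_plane.
move=> y; rewrite normsqE; move: m0; rewrite -dot_eq0 /refl /dot !sum3 !mxE.
move: (m 0 i0) (m 0 i1) (m 0 i2) (y 0 i0) (y 0 i1) (y 0 i2) => m0 m1 m2 y0 y1 y2 n0.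
by field.
Qed.

Lemma local_model_log {R : realType} (U : set 'rV[R]_3) (f v : 'rV[R]_3 -> R)
    (P Q : quad R) (k : R) p :
  open U -> U p -> k != 0 -> (forall x, U x -> 0 < v x) ->
  (forall x, U x -> v x * expR (- k * f x) = quadric Q x) ->
  (forall x, U x -> v x * expR (k * f x) = quadric P x) ->
  pairing Q Q = 0 -> pairing P P = 0 -> pairing P Q = - (2 * k ^+ 2) ->
  local_model U f p.
Proof.
move=> oU Up k0 v0 vQ vP QQ PP PQ.
have [|Psi [psi [T [[mP hPsi pT] TQ]]]] := @null_chart _ U Q QQ.
  by move=> x Ux; rewrite -vQ// mulf_neq0// lt0r_neq0// ?v0// expR_gt0.
move: (pT Q Q) (pT P P) (pT P Q); rewrite QQ PP PQ.
case EQ : (T Q) TQ => [[a b] c] /= cE; subst c.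
rewrite {1}/pairing /= !mulr0 !subr0 => /sum_sq_eq0 b0 PP' PQ'.
have TQE y : quadric (T Q) y = a.
  by rewrite EQ /quadric /= mul0r mul0r addr0 big1 ?addr0// => i _; rewrite b0 mul0r.
have a0 : 0 < a.
  have [_ [rho rho0 hq]] := hPsi p Up.
  have : 0 < quadric Q p by rewrite -vQ// mulr_gt0 ?v0// expR_gt0.
  by rewrite hq TQE pmulr_rgt0.
have c0 : a * (T P).2 = 2 * k ^+ 2.
  move: PQ'; rewrite /pairing /= big1 ?sub0r; last by move=> i _; rewrite b0 mulr0.
  by rewrite mulr0 oppr0 add0r => /oppr_inj.
have c1 : (T P).2 != 0.
  by apply: contra_eq_neq c0 => ->; rewrite mulr0 eq_sym mulf_neq0 ?pnatr_eq0// sqrf_eq0.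
have PE := null_quadric PP' c1.
set m := center (T P) in PE.
pose C := (T P).2 / (2 * a).
have C0 : 0 < C.
  have -> : C = k ^+ 2 / a ^+ 2.
    have -> : C = a * (T P).2 / (2 * a ^+ 2) by rewrite /C; field; rewrite gt_eqF.
    by rewrite c0; field; rewrite gt_eqF.
  by rewrite divr_gt0 ?exprn_even_gt0//= gt_eqF.
have hk x : U x -> expR (2 * k * f x) = C * dot (psi x - m) (psi x - m).
  move=> Ux; have [_ [rho rho0 hq]] := hPsi x Ux.
  have e1 := vP x Ux; have e2 := vQ x Ux.
  rewrite hq PE in e1; rewrite hq TQE in e2.
  have -> : expR (2 * k * f x) = expR (k * f x) / expR (- k * f x).
    by rewrite mulNr expRN invrK -expRD; congr expR; ring.
  have v1 := v0 x Ux.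
  have -> : expR (k * f x) = rho / v x * ((T P).2 / 2 * dot (psi x - m) (psi x - m)).
    by apply: (mulfI (lt0r_neq0 v1)); rewrite e1; field; rewrite gt_eqF.
  have -> : expR (- k * f x) = rho / v x * a.
    by apply: (mulfI (lt0r_neq0 v1)); rewrite e2; field; rewrite gt_eqF.
  by rewrite /C; field; rewrite !gt_eqF.
have psim x : U x -> psi x != m.
  move=> Ux; apply/eqP => pm; have := hk x Ux.
  have -> : dot (psi x - m) (psi x - m) = 0 by apply/eqP; rewrite dot_eq0 pm subrr.
  by rewrite mulr0 => /eqP; rewrite gt_eqF// expR_gt0.
(* the inversion of radius r turns the squared distance d to m into r^4 / d, and the
   choice C r^4 = 1 leaves no additive constant in f *)
pose r := Num.sqrt (Num.sqrt C^-1).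
have r0 : 0 < r by rewrite !sqrtr_gt0 invr_gt0.
have rC : C * (r ^+ 2 * r ^+ 2) = 1.
  by rewrite /r sqr_sqrtr ?sqrtr_ge0// -expr2 sqr_sqrtr ?invr_ge0 1?ltW// divff// gt_eqF.
have [Phi [phi [mPhi PhiE phiN]]] := exists_refl_to_0 m.
pose sg y : 'rV[R]_3 := m + (r ^+ 2 / dot (y - m) (y - m)) *: (y - m).
have hN x : U x -> normsq (phi (sg (psi x))) = expR (- (2 * k * f x)).
  move=> Ux; have d0 : dot (psi x - m) (psi x - m) != 0 by rewrite dot_eq0 subr_eq0 psim.
  rewrite phiN expRN hk// /sg [m + _]addrC addrK.
  have -> (y : 'rV[R]_3) (z : R) : dot (z *: y) (z *: y) = z ^+ 2 * dot y y.
    by rewrite /dot !sum3 !mxE; ring.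
  move: (dot _ _) d0 => d d0; apply: (mulfI (_ : C * d != 0)).
    by rewrite mulf_neq0// gt_eqF.
  have -> : C * d * ((r ^+ 2 / d) ^+ 2 * d) = C * (r ^+ 2 * r ^+ 2) by field.
  by rewrite rC divff// mulf_neq0// gt_eqF.
have phi0 x : U x -> phi (sg (psi x)) != 0.
  by move=> Ux; rewrite -dot_eq0 -normsqE hN// gt_eqF// expR_gt0.
apply: (@local_modelP _ U U (setT `&` [set y | normsq y != 0]) f p (- (2 * k)^-1)
   (Phi \o (sphere_refl m r \o Psi)) (phi \o sg \o psi) (fun y => ln (normsq y))) => //.
- by rewrite oppr_eq0 invr_eq0 mulf_neq0// pnatr_eq0.
- by apply: mPhi; exact: mobius_sphere.
- move=> x Ux; have [PsiE _] := hPsi x Ux; split.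
  + by rewrite /= PsiE /= (negbTE (psim x Ux)) PhiE.
  + by split=> //=; rewrite normsqE dot_eq0 phi0.
  + by rewrite /= hN// expRK; field.
- by apply: Or42 => _ [x Ux <-]; split; [exact: phi0|].
- exact: smooth_ln_normsq.
Qed.

(** * The elliptic pencil and the conclusion *)

Definition comb {R : realType} (x : R) (p : quad R) (y : R) (q : quad R) : quad R :=
  (x * p.1.1 + y * q.1.1, fun i => x * p.1.2 i + y * q.1.2 i, x * p.2 + y * q.2).

Lemma quadric_comb {R : realType} x (p : quad R) y q z :
  quadric (comb x p y q) z = x * quadric p z + y * quadric q z.
Proof. by rewrite /quadric /comb /= !sum3; ring. Qed.

Lemma pairingC {R : realType} (p q : quad R) : pairing p q = pairing q p.
Proof. by rewrite /pairing !sum3; ring. Qed.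

Lemma pairing_comb {R : realType} x (p : quad R) y q r :
  pairing (comb x p y q) r = x * pairing p r + y * pairing q r.
Proof. by rewrite /pairing /comb /= !sum3; ring. Qed.

Lemma plane_at_center {R : realType} (l p : quad R) : p.2 != 0 -> l.2 = 0 ->
  quadric l (center p) = - pairing l p / p.2.
Proof.
case: p => [[a b] c] /= c0; case: l => [[a' b'] c'] /= ->.
rewrite /pairing /quadric !sum3 !mxE /=; by field.
Qed.

Lemma plane_add {R : realType} (l : quad R) (x w : 'rV[R]_3) (r : R) : l.2 = 0 ->
  quadric l (x + r *: w) = quadric l x + r * \sum_i l.1.2 i * w 0 i.
Proof.
case: l => [[a' b'] c'] /= ->.
rewrite /quadric !sum3 !mxE /=; by field.
Qed.

(** With n = (n_0, n_1, n_2), take (- n_1, n_0, 0) up to scale if n_0 is not zero, and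
    the first basis vector otherwise. *)
Lemma exists_unit_orth {R : realType} (n : 'I_3 -> R) :
  exists2 w : 'rV[R]_3, dot w w = 1 & \sum_i n i * w 0 i = 0.
Proof.
pose e : 'rV[R]_3 := \row_(i < 3) (i == i0)%:R.
suff [w w0 nw] : exists2 w : 'rV[R]_3, w != 0 & \sum_i n i * w 0 i = 0.
  have d0 := dot_gt0 w0; pose s := Num.sqrt (dot w w).
  have ss : s * s = dot w w by rewrite -expr2 sqr_sqrtr// ltW.
  have s0 : s != 0 by rewrite gt_eqF// sqrtr_gt0.
  exists (s^-1 *: w).
    have -> : dot (s^-1 *: w) (s^-1 *: w) = s^-1 ^+ 2 * dot w w.
      by rewrite /dot !sum3 !mxE; ring.
    by rewrite -ss; field.
  have -> : \sum_i n i * (s^-1 *: w) 0 i = s^-1 * \sum_i n i * w 0 i.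
    by rewrite !sum3 !mxE; ring.
  by rewrite nw mulr0.
have [n0|n0] := eqVneq (n i0) 0.
  exists (\row_i (i == i0)%:R).
    by apply/eqP => /rowP /(_ i0); rewrite !mxE eqxx => /eqP; rewrite oner_eq0.
  by rewrite sum3 !mxE /= n0; ring.
exists (\row_i (if i == i1 then n i0 else if i == i0 then - n i1 else 0)).
  by apply: contraNneq n0 => /rowP /(_ i1); rewrite !mxE eqxx => ->.
by rewrite sum3 !mxE /=; ring.
Qed.

(** In the pencil of P and Q there are a plane L and a sphere T. They are orthogonal, so
    the plane contains the centre of the sphere, and any point of the sphere in that
    plane is a common zero. *)
Lemma common_zero {R : realType} (P Q : quad R) (k : R) : k != 0 ->
  pairing P P = k ^+ 2 -> pairing Q Q = k ^+ 2 -> pairing P Q = 0 ->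
  (P.2 != 0) || (Q.2 != 0) -> exists m, quadric P m = 0 /\ quadric Q m = 0.
Proof.
move=> k0 PP QQ PQ nz; pose c := P.2; pose c' := Q.2.
pose S := c * c + c' * c'.
have S0 : 0 < S.
  rewrite /S -!expr2; case/orP: nz => h.
    by rewrite ltr_pwDl ?sqr_ge0// exprn_even_gt0.
  by rewrite ltr_wpDl ?sqr_ge0// exprn_even_gt0.
pose T := comb c P c' Q; pose L := comb c' P (- c) Q.
have TT : pairing T T = S * k ^+ 2.
  by rewrite pairing_comb pairingC pairing_comb [X in _ + _ * X]pairingC pairing_comb
    [pairing Q P]pairingC PP QQ PQ /S; ring.
have LT : pairing L T = 0.
  by rewrite pairing_comb pairingC pairing_comb [X in _ + _ * X]pairingC pairing_comb
    [pairing Q P]pairingC PP QQ PQ; ring.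
have T2 : T.2 = S by [].
have T0 : T.2 != 0 by rewrite T2 gt_eqF.
have L2 : L.2 = 0 by rewrite /L /= mulNr mulrC subrr.
have [w ww nw] := exists_unit_orth L.1.2.
pose r := k / Num.sqrt S.
have rr : r ^+ 2 = k ^+ 2 / S by rewrite expr_div_n sqr_sqrtr// ltW.
pose m := center T + r *: w.
have Lm : quadric L m = 0.
  by rewrite plane_add// nw mulr0 addr0 plane_at_center// LT oppr0 mul0r.
have Tm : quadric T m = 0.
  rewrite complete_square// /m [center T + _]addrC addrK TT T2.
  have -> : dot (r *: w) (r *: w) = r ^+ 2 * dot w w by rewrite /dot !sum3 !mxE; ring.
  by rewrite ww rr; field; rewrite gt_eqF.
exists m; move: Tm Lm; rewrite !quadric_comb => e1 e2; split.
  apply: (mulfI (lt0r_neq0 S0)); rewrite mulr0.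
  have -> : S * quadric P m = c * (c * quadric P m + c' * quadric Q m)
     + c' * (c' * quadric P m + (- c) * quadric Q m) by rewrite /S; ring.
  by rewrite e1 e2 !mulr0 addr0.
apply: (mulfI (lt0r_neq0 S0)); rewrite mulr0.
have -> : S * quadric Q m = c' * (c * quadric P m + c' * quadric Q m)
     - c * (c' * quadric P m + (- c) * quadric Q m) by rewrite /S; ring.
by rewrite e1 e2 !mulr0 subr0.
Qed.

Lemma common_zero_chart {R : realType} (U : set 'rV[R]_3) (P Q : quad R) (k : R) : k != 0 ->
  pairing P P = k ^+ 2 -> pairing Q Q = k ^+ 2 -> pairing P Q = 0 ->
  (forall x, U x -> ~ (quadric P x = 0 /\ quadric Q x = 0)) ->
  exists Psi psi T, [/\ chart U Psi psi T, (T P).2 = 0 & (T Q).2 = 0].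
Proof.
move=> k0 PP QQ PQ nz.
have [c0|] := boolP ((P.2 != 0) || (Q.2 != 0)); last first.
  rewrite negb_or !negbK => /andP[/eqP p0 /eqP q0].
  by exists id, id, id; split=> //; exact: chart_id.
have [m [Pm Qm]] := common_zero k0 PP QQ PQ c0.
exists (sphere_refl m 1 \o id), (inversion m), (inv_quad m); split.
- by apply: chart_inversion => x /nz; apply: contra_notN => /eqP ->.
- by rewrite /= Pm mulr0.
- by rewrite /= Qm mulr0.
Qed.

(** The branch of the angle of (y_2, y_3) with values within pi / 2 of th. Centring it
    at the angle of the point of interest makes it smooth there, also where y_2 = 0. *)
Definition rotated_atan {R : realType} (th : R) (y : 'rV[R]_3) : R :=
  th + atan ((crd3 y * cos th - crd2 y * sin th) / (crd2 y * cos th + crd3 y * sin th)).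

Lemma smooth_rotated_atan {R : realType} (th : R) :
  smooth_on (setT `&` [set y : 'rV[R]_3 | crd2 y * cos th + crd3 y * sin th != 0])
    (rotated_atan th).
Proof.
set D := _ `&` _.
have lin (U : set 'rV[R]_3) a b : open U -> smooth_on U (fun y => crd2 y * a + crd3 y * b).
  move=> oU; apply: smooth_add => //; apply: smooth_mul => //;
    by [exact: smooth_coord|exact: smooth_cst].
have oD : open D.
  apply: open_neq0; first exact: openT.
  by move=> x _; exact: (smooth_continuous (lin setT _ _ openT)).
apply: smooth_add => //; first exact: smooth_cst.
have sq : smooth_on D (fun y =>
  (crd3 y * cos th - crd2 y * sin th) / (crd2 y * cos th + crd3 y * sin th)).
  apply: smooth_mul => //; last by apply: smooth_inv => //; [exact: lin|move=> x []].
  apply: (smooth_ext oD _ (lin D (- sin th) (cos th) oD)) => x _.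
  by rewrite mulrN addrC.
apply: (@smooth_comp _ _ _ _ (fun y => (1 + ((crd3 y * cos th - crd2 y * sin th)
  / (crd2 y * cos th + crd3 y * sin th)) ^+ 2)^-1)) => //.
- apply: smooth_inv => //.
    by apply: smooth_add => //; [exact: smooth_cst|exact: smooth_mul].
  by move=> x _; rewrite gt_eqF// ltr_pwDl// sqr_ge0.
- by move=> x _; exact: continuous_atan.
Qed.

Lemma rotated_atanE {R : realType} (th a r : R) (y : 'rV[R]_3) : r != 0 ->
  crd2 y = r * cos a -> crd3 y = r * sin a -> `|a - th| < pi / 2 ->
  crd2 y * cos th + crd3 y * sin th != 0 /\ rotated_atan th y = a.
Proof.
move=> r0 e2 e3 ath.
have e4 : crd2 y * cos th + crd3 y * sin th = r * cos (a - th).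
  by rewrite e2 e3 cosB; ring.
have e5 : crd3 y * cos th - crd2 y * sin th = r * sin (a - th).
  by rewrite e2 e3 sinB; ring.
have aI : a - th \in `](- (pi / 2)), (pi / 2)[ by rewrite in_itv/= -ltr_norml.
have c0 : cos (a - th) != 0 by rewrite gt_eqF// cos_gt0_pihalf// -ltr_norml.
split; first by rewrite e4 mulf_neq0.
rewrite /rotated_atan e4 e5.
have -> : r * sin (a - th) / (r * cos (a - th)) = tan (a - th).
  by rewrite /tan; field; rewrite r0 c0.
by rewrite tanK// addrC subrK.
Qed.

Lemma local_model_arctan {R : realType} (U : set 'rV[R]_3) (f v : 'rV[R]_3 -> R)
    (P Q : quad R) (k : R) p :
  open U -> U p -> 0 < k -> (forall x, U x -> {for x, continuous f}) ->
  (forall x, U x -> 0 < v x) ->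
  (forall x, U x -> v x * cos (k * f x) = quadric Q x) ->
  (forall x, U x -> v x * sin (k * f x) = quadric P x) ->
  pairing Q Q = k ^+ 2 -> pairing P P = k ^+ 2 -> pairing P Q = 0 ->
  local_model U f p.
Proof.
move=> oU Up k0 cf v0 vQ vP QQ PP PQ.
have kn := lt0r_neq0 k0.
have [|Psi [psi [T [[mP hPsi pT] TP TQ]]]] := @common_zero_chart _ U P Q k kn PP QQ PQ.
  move=> x Ux [P0 Q0]; move: (vQ x Ux) (vP x Ux); rewrite P0 Q0.
  move=> /eqP; rewrite mulf_eq0 (gt_eqF (v0 x Ux)) /= => /eqP c0.
  move=> /eqP; rewrite mulf_eq0 (gt_eqF (v0 x Ux)) /= => /eqP s0.
  have := cos2Dsin2 (k * f x); rewrite c0 s0 !expr0n addr0 => /eqP.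
  by rewrite eq_sym oner_eq0.
move: (pT Q Q) (pT P P) (pT Q P); rewrite QQ PP [pairing Q P]pairingC PQ.
case EQ : (T Q) TQ => [[a b] c] /= cE; subst c.
case EP : (T P) TP => [[a' b'] c'] /= cE'; subst c'.
rewrite /pairing /= !mulr0 !subr0 => bb bb' bb0.
have nrm (x y : 'I_3 -> R) z : \sum_i x i * y i = z ->
    \sum_i (x i / k) * (y i / k) = z / k ^+ 2.
  move=> <-; rewrite !sum3; by field.
have i12 : i1 != i2 by [].
have [||| s [s' [t [t' [w [w' [ss ss' w0 w0' hw]]]]]]] :=
    @refl_pair _ (fun i => b i / k) (fun i => b' i / k) (a / k) (a' / k) i1 i2 i12.
- by rewrite (nrm _ _ _ bb) divff// expf_neq0.
- by rewrite (nrm _ _ _ bb') divff// expf_neq0.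
- by rewrite (nrm _ _ _ bb0) mul0r.
have TQE y : quadric (T Q) y = k * (a / k + \sum_i (b i / k) * y 0 i).
  by rewrite EQ /quadric /= !sum3; field.
have TPE y : quadric (T P) y = k * (a' / k + \sum_i (b' i / k) * y 0 i).
  by rewrite EP /quadric /= !sum3; field.
have s0 : s != 0 by apply/eqP => s0; move: ss; rewrite s0 mul0r => /eqP; rewrite eq_sym oner_eq0.
have s0' : s' != 0 by apply/eqP => s1; move: ss'; rewrite s1 mul0r => /eqP; rewrite eq_sym oner_eq0.
(* the two reflections may reverse the orientation of the plane (y_2, y_3) *)
pose g := s * s'.
have gg : g * g = 1 by rewrite mulrACA ss ss' mulr1.
have g0 : g != 0 by rewrite mulf_neq0.
have gE : g = 1 \/ g = -1.
  have : (g - 1) * (g + 1) = 0 by rewrite mulrDr mulrBl gg; ring.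
  by move/eqP; rewrite mulf_eq0 subr_eq0 addr_eq0 => /orP[] /eqP; [left|right].
pose phi y := refl w' t' (refl w t y).
pose N := U `&` [set x | `|k * f x - k * f p| < pi / 2].
have pi2 : 0 < pi / 2 :> R by rewrite divr_gt0// pi_gt0.
have oN : open N.
  rewrite openE => x [Ux fx]; apply: filterI; first exact: open_nbhs_nbhs.
  have e0 : 0 < (pi / 2 - `|k * f x - k * f p|) / k by rewrite divr_gt0// subr_gt0.
  apply: filterS (continuous_near_dist e0 (cf x Ux)) => y /=.
  rewrite ltr_pdivlMr// => h.
  apply: le_lt_trans (ler_distD (k * f x) _ _) _.
  rewrite -ltrBrDr; apply: le_lt_trans h.
  by rewrite -mulrBr normrM (gtr0_norm k0) distrC mulrC.
have Np : N p by split=> //=; rewrite subrr normr0.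
have NU : N `<=` U by move=> x [].
have hphi x : N x -> exists2 r : R, r != 0 &
    crd2 (phi (psi x)) = r * cos (g * (k * f x)) /\ crd3 (phi (psi x)) = r * sin (g * (k * f x)).
  move=> [Ux _]; have [_ [rho rho0 hq]] := hPsi x Ux.
  have [h1 h2] := hw (psi x).
  have eQ := vQ x Ux; have eP := vP x Ux.
  rewrite hq TQE in eQ; rewrite hq TPE in eP.
  have vn := lt0r_neq0 (v0 x Ux); have rn := lt0r_neq0 rho0.
  have cg : cos (g * (k * f x)) = cos (k * f x).
    by case: gE => ->; rewrite ?mul1r// mulN1r cosN.
  have sg : sin (g * (k * f x)) = g * sin (k * f x).
    by case: gE => ->; rewrite ?mul1r// !mulN1r sinN.
  exists (s * (v x / (rho * k))).
    by rewrite mulf_neq0// mulf_neq0// invr_eq0 mulf_neq0.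
  split.
    rewrite /crd2 /phi h1 cg -!mulrA; congr (_ * _).
    apply: (mulfI rn); apply: (mulfI kn).
    rewrite mulrCA -eQ; by field; rewrite rn kn.
  rewrite /crd3 /phi h2 sg.
  have -> : s * (v x / (rho * k)) * (g * sin (k * f x))
      = s * s * s' * (v x * sin (k * f x)) / (rho * k) by rewrite /g; ring.
  by rewrite ss mul1r eP; field; rewrite rn kn.
have near_a x : N x -> `|g * (k * f x) - g * (k * f p)| < pi / 2.
  move=> [_ h]; rewrite -mulrBr normrM.
  have -> : `|g| = 1 by case: gE => ->; rewrite ?normrN normr1.
  by rewrite mul1r.
have hN x : N x ->
    crd2 (phi (psi x)) * cos (g * (k * f p)) + crd3 (phi (psi x)) * sin (g * (k * f p)) != 0
    /\ rotated_atan (g * (k * f p)) (phi (psi x)) = g * (k * f x).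
  move=> Nx; have [r r0 [e2 e3]] := hphi x Nx.
  exact: rotated_atanE r0 e2 e3 (near_a x Nx).
apply: (@local_modelP _ U N (setT `&` [set y : 'rV[R]_3 |
     crd2 y * cos (g * (k * f p)) + crd3 y * sin (g * (k * f p)) != 0]) f p (g / k)
   (plane_refl w' t' \o (plane_refl w t \o Psi)) (phi \o psi)
   (rotated_atan (g * (k * f p)))) => //.
- by rewrite mulf_neq0// invr_eq0.
- by apply: mobius_plane => //; exact: mobius_plane.
- move=> x Nx; have [PsiE _] := hPsi x (NU x Nx); have [n0 hE] := hN x Nx; split.
  + by rewrite /= PsiE.
  + by split.
  + rewrite /= hE.
    have -> : g / k * (g * (k * f x)) = g * g * (k / k) * f x by ring.
    by rewrite gg divff// !mul1r.
- apply: Or43 => _ [x Nx <-]; have [r r0 [e2 e3]] := hphi x Nx; have [n0 hE] := hN x Nx.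
  split; last by rewrite /= hE e2 e3; ring.
  rewrite /= e2 e3; apply/eqP => -[] /eqP; rewrite mulf_eq0 (negbTE r0) /= => /eqP c0.
  move=> /eqP; rewrite mulf_eq0 (negbTE r0) /= => /eqP s1.
  have := cos2Dsin2 (g * (k * f x)); rewrite c0 s1 !expr0n addr0 => /eqP.
  by rewrite eq_sym oner_eq0.
- exact: smooth_rotated_atan.
Qed.

Unset Implicit Arguments.

Theorem theorem11 (R : realType) (U : set 'rV[R]_3) (f : 'rV[R]_3 -> R)
    (openU : open U) (connectedU : connected U)
    (smoothf : smooth_on U f)
    (nonconstant : ~ exists k : R, forall x, U x -> f x = k)
    (X0 : forall x, U x -> invX f x = 0)
    (Y0 : forall x, U x -> invY f x = 0) :
  forall p, U p ->
  exists W : set 'rV[R]_3,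
    [/\ open W, W p, W `<=` U &
      exists (c : R)
             (Phi : one_point_compactification 'rV[R]_3 ->
                    one_point_compactification 'rV[R]_3)
             (V : set 'rV[R]_3) (h : 'rV[R]_3 -> R),
        [/\ c != 0, mobius Phi,
            Phi @` (Some @` W) = Some @` V,
            model_on V h /\ smooth_on V h &
            forall x y, W x -> Phi (Some x) = Some y -> f x = c * h y]].
Proof.
move=> p Up.
have [k0 [v [L [v0 hL pL]]]] := conformal_lift openU connectedU smoothf nonconstant X0 Y0.
have cf x : U x -> {for x, continuous f} := @smooth_continuous _ U f x smoothf.
have [k00|k00|k00] := ltrgt0P k0.
- pose k := Num.sqrt k0; have kk : k0 = k ^+ 2 by rewrite sqr_sqrtr// ltW.
  have kp : 0 < k by rewrite sqrtr_gt0.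
  have oc := ode_cos k; have os := ode_sin k; rewrite -kk in oc os.
  apply: (@local_model_arctan _ U f v (L _ _) (L _ _) k p openU Up kp cf v0 (hL _ _ oc) (hL _ _ os)).
  + rewrite (pL _ _ _ _ oc oc p Up) kk.
    by move: (cos2Dsin2 (k * f p)) => e; rewrite -[RHS]mulr1 -e; ring.
  + rewrite (pL _ _ _ _ os os p Up) kk.
    by move: (cos2Dsin2 (k * f p)) => e; rewrite -[RHS]mulr1 -e; ring.
  + by rewrite (pL _ _ _ _ os oc p Up) kk; ring.
- pose k := Num.sqrt (- k0).
  have kk : k0 = - k ^+ 2 by rewrite sqr_sqrtr ?opprK// oppr_ge0 ltW.
  have kn : k != 0 by rewrite gt_eqF// sqrtr_gt0 oppr_gt0.
  have o1 := ode_exp k; have o2 := ode_exp (- k).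
  rewrite sqrrN -kk in o2; rewrite -kk in o1.
  have ee : expR (k * f p) * expR (- k * f p) = 1 by rewrite -expRD mulNr subrr expR0.
  apply: (@local_model_log _ U f v (L _ _) (L _ _) k p openU Up kn v0 (hL _ _ o2) (hL _ _ o1)).
  + by rewrite (pL _ _ _ _ o2 o2 p Up) kk; ring.
  + by rewrite (pL _ _ _ _ o1 o1 p Up) kk; ring.
  + rewrite (pL _ _ _ _ o1 o2 p Up) kk; move: ee.
    by move: (expR (k * f p)) (expR (- k * f p)) => x y xy; ring: xy.
- rewrite k00 in hL pL; have o1 := @ode_cst R; have o2 := @ode_id R.
  apply: (@local_model_linear _ U f v (L _ _) (L _ _) p openU Up v0
    (fun x Ux => etrans (esym (mulr1 _)) (hL _ _ o1 x Ux)) (hL _ _ o2)).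
  + by rewrite (pL _ _ _ _ o1 o1 p Up); ring.
  + by rewrite (pL _ _ _ _ o2 o2 p Up); ring.
  + by rewrite (pL _ _ _ _ o2 o1 p Up); ring.
Qed.
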